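(* Let $\mathcal S_0$ be a shape that is neither a disk, nor an arc of a circle, nor a segment. If the position of the solid is given, then the complex potential determines its velocity: if $\mathbf p$ is a position and $\mathbf v_1,\mathbf v_2$ are two rigid velocity fields such that the complex potentials corresponding to the configurations $(\mathbf p,\mathbf v_1)$ and $(\mathbf p,\mathbf v_2)$ are equal, then $\mathbf v_1=\mathbf v_2$.
   Context: The plane $\mathbf R^2$ is identified with $\mathbf C$. Shape: a simply connected compact set $\mathcal S_0\subset\mathbf C$ whose exterior $\mathcal F_0=\mathbf C\setminus\mathcal S_0$ is the image of $\Omega=\{|z|>1\}$ under a conformal (holomorphic, injective) map $f(z)=c_1z+\sum_{k\leq -1}c_kz^k$ with $c_1\neq 0$ and $\sum_k|c_k|<\infty$ (the constant term is normalized to $0$ by translation); thus $f$ extends continuously to $\{|z|\ge 1\}$. One-dimensional sets are allowed as degenerate cases. Position: a triplet $\mathbf p=(\theta,\mathbf s,\mathbf r)\in\mathbf R/2\pi\times\mathbf C\times\mathbf C$ acting by $\mathbf p z=e^{i\theta}(z-\mathbf s)+\mathbf r$; two triplets are identified when they give the same set $\mathcal S=\mathbf p(\mathcal S_0)$. Velocity: a rigid velocity field $\mathbf v(z)=i\omega(z-\mathbf s)+w$ with $\omega\in\mathbf R$, $\mathbf s,w\in\mathbf C$; triplets $(\omega,\mathbf s,w)$ giving the same field are identified. A configuration is a pair $(\mathbf p,\mathbf v)$. Complex potential: for a configuration $(\mathbf p,\mathbf v)$, with $\mathcal S=\mathbf p(\mathcal S_0)$ and $\mathcal F=\mathbf C\setminus\mathcal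 S$, it is the unique holomorphic function $\xi=\varphi+i\psi$ on $\mathcal F$ with $\xi(z)\to 0$ as $|z|\to\infty$ and satisfying the slip condition $\partial_n\varphi=\mathbf v\cdot\mathbf n$ on $\partial\mathcal S$. The slip condition is understood in integrated form: $\xi\circ\mathbf p\circ f$ extends continuously to $\{|z|\geq 1\}$ and there is a real constant $C$ such that $\operatorname{Im}\xi(x)=\operatorname{Im}(\bar w x)-\frac{\omega}{2}|x-\mathbf s|^2+C$ for $x=\mathbf p(f(z))$, $|z|=1$ (boundary values taken through this extension). *)

(* Defs.v *)
From Stdlib Require Import Reals List.
From Coquelicot Require Import Coquelicot.
Open Scope R_scope.

Definition compact_set {T : UniformSpace} (K : T -> Prop) : Prop :=
  forall (I : Type) (U : I -> T -> Prop),
    (forall i, open (U i)) ->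
    (forall x, K x -> exists i, U i x) ->
    exists l : list I, forall x, K x -> exists i, In i l /\ U i x.

Definition unit_interval (t : R) : Prop := 0 <= t <= 1.

Definition unit_square (q : R * R) : Prop :=
  unit_interval (fst q) /\ unit_interval (snd q).

Definition path_in (S : C -> Prop) (g : R -> C) : Prop :=
  continuous_on unit_interval g /\ (forall t, unit_interval t -> S (g t)).

Definition path_connected (S : C -> Prop) : Prop :=
  (exists x, S x) /\
  forall x y, S x -> S y -> exists g, path_in S g /\ g 0 = x /\ g 1 = y.

(* Homotopy in S, relative to the base point, to the constant loop: the first
   argument of h is the parameter of the loop, the second one is the time. *)
Definition null_homotopic_in (S : C -> Prop) (g : R -> C) : Prop :=
  exists h : R * R -> C,
    continuous_on unit_square h /\
    (forall q, unit_square q -> S (h q)) /\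
    (forall t, unit_interval t -> h (t, 0) = g t) /\
    (forall t, unit_interval t -> h (t, 1) = g 0) /\
    (forall u, unit_interval u -> h (0, u) = g 0 /\ h (1, u) = g 0).

Definition simply_connected (S : C -> Prop) : Prop :=
  path_connected S /\
  forall g, path_in S g -> g 0 = g 1 -> null_homotopic_in S g.

Definition cis (t : R) : C := (cos t, sin t).

Definition is_disk (S : C -> Prop) : Prop :=
  exists (a : C) (r : R), 0 < r /\ forall z, S z <-> Cmod (z - a)%C <= r.

(* The whole circle is not an arc. *)
Definition is_circle_arc (S : C -> Prop) : Prop :=
  exists (a : C) (r t1 t2 : R),
    0 < r /\ t1 < t2 < t1 + 2 * PI /\
    forall z, S z <-> exists t, t1 <= t <= t2 /\ z = (a + r * cis t)%C.

Definition is_segment (S : C -> Prop) : Prop :=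
  exists a b : C,
    a <> b /\
    forall z, S z <-> exists t : R, 0 <= t <= 1 /\ z = (a + t * (b - a))%C.

Definition Omega (z : C) : Prop := 1 < Cmod z.

Definition Omega_bar (z : C) : Prop := 1 <= Cmod z.

Definition holomorphic_on (D : C -> Prop) (g : C -> C) : Prop :=
  forall z, D z -> ex_derive (K := C_AbsRing) (V := C_NormedModule) g z.

(* [c n] is the coefficient of index -(n+1) of the Laurent expansion of f.
   The expansion is required on the closed set [Omega_bar], so that there f
   is its own continuous extension; values of f elsewhere are irrelevant. *)
Definition laurent_expansion (f : C -> C) : Prop :=
  exists (c1 : C) (c : nat -> C),
    c1 <> 0%C /\
    ex_series (fun n => Cmod (c n)) /\
    forall z, Omega_bar z ->
      is_series (K := C_AbsRing) (V := C_NormedModule)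
        (fun n => (c n / z ^ S n)%C) (f z - c1 * z)%C.

(* S0 is a shape and f is a conformal map of Omega onto its exterior. *)
Definition is_shape (S0 : C -> Prop) (f : C -> C) : Prop :=
  compact_set S0 /\
  simply_connected S0 /\
  laurent_expansion f /\
  holomorphic_on Omega f /\
  (forall z1 z2, Omega z1 -> Omega z2 -> f z1 = f z2 -> z1 = z2) /\
  (forall x, ~ S0 x <-> exists z, Omega z /\ f z = x).

(* A representative (theta, s, r) of a position. Replacing it by another one
   with the same image of S0 does not change the complex potentials below. *)
Record position : Type := Position {
  pos_angle : R;
  pos_center : C;
  pos_target : C
}.

Definition act (p : position) (z : C) : C :=
  (cis (pos_angle p) * (z - pos_center p) + pos_target p)%C.

Definition placed (p : position) (S0 : C -> Prop) (x : C) : Prop :=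
  exists z, S0 z /\ x = act p z.

(* A representative (omega, s, w) of a rigid velocity. *)
Record velocity : Type := Velocity {
  vel_omega : R;
  vel_center : C;
  vel_w : C
}.

Definition velocity_field (v : velocity) (z : C) : C :=
  (Ci * vel_omega v * (z - vel_center v) + vel_w v)%C.

Definition same_velocity (v1 v2 : velocity) : Prop :=
  forall z, velocity_field v1 z = velocity_field v2 z.

Definition vanishes_at_infinity (D : C -> Prop) (xi : C -> C) : Prop :=
  forall eps : R, 0 < eps ->
    exists M : R, forall z, D z -> M < Cmod z -> Cmod (xi z) < eps.

(* g is the continuous extension of
   xi o p o f to [Omega_bar]. *)
Definition slip_condition
  (f : C -> C) (p : position) (v : velocity) (xi : C -> C) : Prop :=
  exists g : C -> C,
    continuous_on Omega_bar g /\
    (forall z, Omega z -> g z = xi (act p (f z))) /\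
    exists K : R, forall z, Cmod z = 1 ->
      let x := act p (f z) in
      Im (g z) = Im (Cconj (vel_w v) * x)%C
                 - vel_omega v / 2 * (Cmod (x - vel_center v)%C) ^ 2 + K.

(* Only the values of xi on the exterior of the solid are meaningful. *)
Definition is_complex_potential (S0 : C -> Prop) (f : C -> C)
  (p : position) (v : velocity) (xi : C -> C) : Prop :=
  let F := fun x => ~ placed p S0 x in
  holomorphic_on F xi /\
  vanishes_at_infinity F xi /\
  slip_condition f p v xi.

(* Main.v *)
(** Two equal potentials have boundary values differing by a constant, so the
    difference of the two slip conditions says that the image of the unit circle
    under f satisfies A |x|^2 + B x_1 + C x_2 + D = 0, where (A, B, C) vanishes
    exactly when the two velocity fields agree.  Otherwise f maps the unit circle
    into a line or a circle.  A path from the exterior of the solid to the solid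
    meets the image of the unit circle; moving along straight paths, one finds
    that the solid is a disk, or a compact connected subset of a line or of a
    circle minus a point, hence a segment, an arc or a single point.

    A single point is impossible: f would be constant on the unit circle
    (boundary values of the univalent f are never interior values, by the open
    mapping property), and averaging over roots of unity would give c_1 = 0.
    The open mapping property comes from a minimum modulus argument: near a
    point of Omega an absolutely convergent Laurent series is its value plus a
    power of a local coordinate times a nonvanishing factor. *)

Require Import Defs.
From Stdlib Require Import Reals List Lra Lia Classical ClassicalEpsilon.
From Coquelicot Require Import Coquelicot.
Open Scope R_scope.

(** * Compactness and connectedness *)


Lemma Re_le_Cmod (z : C) : Rabs (fst z) <= Cmod z.
Proof. exact (re_le_Cmod z). Qed.

Lemma Im_le_Cmod (z : C) : Rabs (snd z) <= Cmod z.
Proof. exact (Rle_trans _ _ _ (Rmax_r _ _) (Rmax_Cmod z)). Qed.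

Lemma Cmod_le_sum (z : C) : Cmod z <= Rabs (fst z) + Rabs (snd z).
Proof.
  assert (H : z = (RtoC (fst z) + Ci * RtoC (snd z))%C)
    by (destruct z; unfold Ci, Cmult, Cplus, RtoC; simpl; f_equal; ring).
  rewrite H at 1. eapply Rle_trans; [apply Cmod_triangle|].
  rewrite Cmod_mult, Cmod_Ci, !Cmod_R. lra.
Qed.

Lemma Cmod_minus_sym (x y : C) : Cmod (x - y)%C = Cmod (y - x)%C.
Proof. rewrite <- Cmod_opp. f_equal. ring. Qed.

Lemma Cmod_triangle_rev (x y : C) : Cmod x - Cmod y <= Cmod (x - y)%C.
Proof.
  replace x with ((x - y) + y)%C at 1 by ring.
  generalize (Cmod_triangle (x - y) y). lra.
Qed.

Lemma Cmod_minus_triangle (x y z : C) :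
  Cmod (x - z)%C <= Cmod (x - y)%C + Cmod (y - z)%C.
Proof.
  replace (x - z)%C with ((x - y) + (y - z))%C by ring. apply Cmod_triangle.
Qed.

(** The balls of [C_UniformSpace] are squares, because [C] carries the product structure of two
    copies of [R]. This lemma and the next pass between squares and round disks; the way back costs
    a factor 2. *)
Lemma ball_of_Cmod (x y : C) (e : R) :
  Cmod (y - x)%C < e -> ball (M := C_UniformSpace) x e y.
Proof.
  intros H. split.
  - generalize (Re_le_Cmod (y - x)%C). unfold ball; simpl.
    unfold AbsRing_ball, abs, minus, plus, opp; simpl. unfold Rminus. lra.
  - generalize (Im_le_Cmod (y - x)%C). unfold ball; simpl.
    unfold AbsRing_ball, abs, minus, plus, opp; simpl. lra.
Qed.

Lemma Cmod_of_ball (x y : C) (e : R) :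
  ball (M := C_UniformSpace) x e y -> Cmod (y - x)%C < 2 * e.
Proof.
  intros [H1 H2]. generalize (Cmod_le_sum (y - x)%C).
  unfold ball in H1, H2; simpl in *.
  unfold AbsRing_ball, abs, minus, plus, opp in *; simpl in *. lra.
Qed.

Lemma Cminus_diag (x : C) : (x - x)%C = 0.
Proof. ring. Qed.

Definition eps_cont_on (K : C -> Prop) (h : C -> R) : Prop :=
  forall x, K x -> forall e, 0 < e -> exists d, 0 < d /\
    forall y, K y -> Cmod (y - x)%C < d -> Rabs (h y - h x) < e.

Lemma continuous_on_eps (K : C -> Prop) (g : C -> C) :
  continuous_on (T := C_UniformSpace) (U := C_UniformSpace) K g ->
  forall x, K x -> forall e, 0 < e -> exists d, 0 < d /\
    forall y, K y -> Cmod (y - x)%C < d -> Cmod (g y - g x)%C < e.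
Proof.
  intros H x Kx e He.
  assert (He2 : 0 < e / 2) by lra.
  destruct (H x Kx (fun y => Cmod (y - g x)%C < e)) as [d Hd].
  { exists (mkposreal _ He2). intros y Hy. apply Cmod_of_ball in Hy.
    simpl in Hy. lra. }
  exists d; split; [apply cond_pos|]. intros y Ky Hy.
  exact (Hd y (ball_of_Cmod _ _ _ Hy) Ky).
Qed.

Lemma path_continuous_eps (g : R -> C) :
  continuous_on (T := R_UniformSpace) (U := C_UniformSpace) unit_interval g ->
  forall t, 0 <= t <= 1 -> forall e, 0 < e -> exists d, 0 < d /\
    forall s, 0 <= s <= 1 -> Rabs (s - t) < d -> Cmod (g s - g t)%C < e.
Proof.
  intros H t Kt e He.
  assert (He2 : 0 < e / 2) by lra.
  destruct (H t Kt (fun y => Cmod (y - g t)%C < e)) as [d Hd].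
  { exists (mkposreal _ He2). intros y Hy. apply Cmod_of_ball in Hy.
    simpl in Hy. lra. }
  exists d; split; [apply cond_pos|]. intros s Ks Hs. exact (Hd s Hs Ks).
Qed.

Lemma open_disk (x : C) (e : R) :
  open (T := C_UniformSpace) (fun y => Cmod (y - x)%C < e).
Proof.
  intros y Hy. assert (Hp : 0 < (e - Cmod (y - x)%C) / 2) by lra.
  exists (mkposreal _ Hp). intros z Hz. apply Cmod_of_ball in Hz. simpl in Hz.
  generalize (Cmod_minus_triangle z y x). lra.
Qed.

(* Compactness as the passage from local to uniform lower bounds. *)
Definition uniformizing (K : C -> Prop) : Prop :=
  forall Q : R -> C -> Prop,
    (forall e e' y, 0 < e' <= e -> Q e y -> Q e' y) ->
    (forall x, K x -> exists e, 0 < e /\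
       forall y, K y -> Cmod (y - x)%C < e -> Q e y) ->
    exists d, 0 < d /\ forall y, K y -> Q d y.

(** Cover [K] by all disks on which [Q] already holds at their own radius. The smallest radius of a
    finite subcover works everywhere, since [Q] passes to smaller positive values. *)
Lemma compact_set_uniformizing (K : C -> Prop) :
  compact_set (T := C_UniformSpace) K -> uniformizing K.
Proof.
  intros HK Q Qmono Hloc.
  destruct (HK {p : C * R | 0 < snd p /\
      forall y, K y -> Cmod (y - fst p)%C < snd p -> Q (snd p) y}
    (fun p y => Cmod (y - fst (proj1_sig p))%C < snd (proj1_sig p)))
    as [l Hl].
  - intros i. apply open_disk.
  - intros x Kx. destruct (Hloc x Kx) as [e [He H]].
    exists (exist _ (x, e) (conj He H)). simpl.
    rewrite Cminus_diag, Cmod_0. exact He.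
  - assert (Hmin : exists d, 0 < d /\
        forall i, In i l -> d <= snd (proj1_sig i)).
    { clear Hl. induction l as [|i l [d [Hd IH]]].
      - exists 1. split; [lra|]. intros i [].
      - exists (Rmin d (snd (proj1_sig i))). split.
        + apply Rmin_pos; [exact Hd|]. apply (proj2_sig i).
        + intros j [<-|Hj]; [apply Rmin_r|].
          eapply Rle_trans; [apply Rmin_l|]. apply IH, Hj. }
    destruct Hmin as [d [Hd Hmin]]. exists d. split; [exact Hd|].
    intros y Ky. destruct (Hl y Ky) as [i [Hi Hy]].
    apply (Qmono (snd (proj1_sig i))); [split; [exact Hd|apply Hmin, Hi]|].
    exact (proj2 (proj2_sig i) y Ky Hy).
Qed.

Definition eps_closed (K : C -> Prop) : Prop :=
  forall x, ~ K x -> exists e, 0 < e /\ forall y, Cmod (y - x)%C < e -> ~ K y.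

Definition norm_bounded (K : C -> Prop) : Prop :=
  exists M, forall y, K y -> Cmod y <= M.

Lemma closed_bounded_uniformizing (K : C -> Prop) :
  eps_closed K -> norm_bounded K -> uniformizing K.
Proof.
  intros Hcl [M HM] Q Qmono Hloc.
  (* A gauge at every point of the plane: near [K] it controls [Q], off [K] it isolates the point
     from [K]. The radius is doubled because two coordinates within [e] only give a distance below
     [2 * e]. *)
  assert (Hch : forall x : C, exists e : posreal,
    (K x -> forall y, K y -> Cmod (y - x)%C < 2 * e -> Q (2 * e) y) /\
    (~ K x -> forall y, Cmod (y - x)%C < 2 * e -> ~ K y)).
  { intros x. destruct (classic (K x)) as [Kx|Kx].
    - destruct (Hloc x Kx) as [e [He H]].
      assert (He2 : 0 < e / 2) by lra.
      exists (mkposreal _ He2). simpl. replace (2 * (e / 2)) with e by field.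
      tauto.
    - destruct (Hcl x Kx) as [e [He H]].
      assert (He2 : 0 < e / 2) by lra.
      exists (mkposreal _ He2). simpl. replace (2 * (e / 2)) with e by field.
      tauto. }
  pose (delta := fun u v : R =>
    proj1_sig (constructive_indefinite_description _ (Hch (u, v)))).
  destruct (compactness_value_2d (- M) M (- M) M delta) as [d Hd].
  exists d. split; [apply cond_pos|]. intros [a b] Ky.
  generalize (HM _ Ky) (Re_le_Cmod (a, b)) (Im_le_Cmod (a, b)). simpl.
  intros H1 H2 H3.
  assert (Ha : - M <= a <= M) by (apply Rabs_le_between; lra).
  assert (Hb : - M <= b <= M) by (apply Rabs_le_between; lra).
  generalize (NNPP _ (Hd a b Ha Hb)). intros [u [v [_ [_ [Hu [Hv Hdl]]]]]].
  unfold delta in *.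
  destruct (constructive_indefinite_description _ (Hch (u, v))) as [e [E1 E2]].
  simpl in *.
  assert (Hdist : Cmod ((a, b) - (u, v))%C < 2 * e).
  { generalize (Cmod_le_sum ((a, b) - (u, v))%C). simpl. unfold Rminus in *.
    lra. }
  destruct (classic (K (u, v))) as [Kuv|Kuv].
  - apply (Qmono (2 * e)); [generalize (cond_pos d) (cond_pos e); lra|].
    exact (E1 Kuv _ Ky Hdist).
  - destruct (E2 Kuv _ Hdist Ky).
Qed.

Lemma uniformizing_bounded (K : C -> Prop) : uniformizing K -> norm_bounded K.
Proof.
  (* An upper bound on the modulus is turned into a property that improves as [e] shrinks by writing
     it as [/ e]. *)
  intros HK. destruct (HK (fun e y => Cmod y <= / e)) as [d [Hd H]].
  - intros e e' y He H. eapply Rle_trans; [exact H|].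
    apply Rinv_le_contravar; lra.
  - intros x _. exists (/ (Cmod x + 1)).
    assert (Hx := Cmod_ge_0 x).
    assert (Hi : 0 < / (Cmod x + 1)) by (apply Rinv_0_lt_compat; lra).
    split; [exact Hi|]. intros y _ Hy. rewrite Rinv_inv.
    assert (/ (Cmod x + 1) <= / 1) by (apply Rinv_le_contravar; lra).
    rewrite Rinv_1 in H. generalize (Cmod_triangle_rev y x). lra.
  - exists (/ d). exact H.
Qed.

Lemma uniformizing_closed (K : C -> Prop) : uniformizing K -> eps_closed K.
Proof.
  intros HK x0 Hx0. destruct (HK (fun e y => e <= Cmod (y - x0)%C))
    as [d [Hd H]].
  - intros e e' y He H. lra.
  - intros x Kx. exists (Cmod (x - x0)%C / 2).
    assert (Hp : 0 < Cmod (x - x0)%C).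
    { apply Cmod_gt_0. intros E. apply Hx0.
      replace x0 with x; [exact Kx|].
      replace x with ((x - x0) + x0)%C by ring. rewrite E. ring. }
    split; [lra|]. intros y _ Hy.
    generalize (Cmod_minus_triangle x y x0). rewrite (Cmod_minus_sym x y). lra.
  - exists d. split; [exact Hd|]. intros y Hy Ky. generalize (H y Ky). lra.
Qed.

(** Uniformization is used twice: once to bound [h] below, once to show that an infimum which is not
    attained would be exceeded by a uniform margin. *)
Lemma uniformizing_min (K : C -> Prop) (h : C -> R) :
  uniformizing K -> (exists x, K x) -> eps_cont_on K h ->
  exists x, K x /\ forall y, K y -> h x <= h y.
Proof.
  intros HK [x0 Kx0] Hh.
  destruct (HK (fun e y => - / e <= h y)) as [d0 [Hd0 H0]].
  { intros e e' y He H. assert (/ e <= / e') by (apply Rinv_le_contravar; lra).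
    lra. }
  { intros x Kx. destruct (Hh x Kx 1 Rlt_0_1) as [d [Hd H]].
    assert (Hp : 0 < Rabs (h x) + 1) by (generalize (Rabs_pos (h x)); lra).
    exists (Rmin d (/ (Rabs (h x) + 1))). split.
    - apply Rmin_pos; [exact Hd|]. apply Rinv_0_lt_compat, Hp.
    - intros y Ky Hy.
      assert (Hr : Rabs (h x) + 1 <= / Rmin d (/ (Rabs (h x) + 1))).
      { rewrite <- (Rinv_inv (Rabs (h x) + 1)) at 1.
        apply Rinv_le_contravar; [|apply Rmin_r].
        apply Rmin_pos; [exact Hd|]. apply Rinv_0_lt_compat, Hp. }
      assert (Hy' : Rabs (h y - h x) < 1).
      { apply H; [exact Ky|]. eapply Rlt_le_trans; [exact Hy|apply Rmin_l]. }
      apply Rabs_lt_between in Hy'.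
      generalize (Rle_abs (- h x)). rewrite Rabs_Ropp. lra. }
  (* Completeness provides suprema, so the infimum of [h] is obtained as [- m]. *)
  destruct (completeness (fun v => exists y, K y /\ v = - h y)) as [m [Hm1 Hm2]].
  { exists (/ d0). intros v [y [Ky ->]]. generalize (H0 y Ky). lra. }
  { exists (- h x0), x0. auto. }
  apply NNPP. intros Hno.
  destruct (HK (fun e y => - m + e <= h y)) as [d [Hd H]].
  { intros e e' y He H. lra. }
  { intros x Kx.
    assert (Hx : - m < h x).
    { destruct (Rle_lt_dec (h x) (- m)) as [Hle|Hlt]; [|exact Hlt].
      exfalso. apply Hno. exists x. split; [exact Kx|]. intros y Ky.
      assert (- h y <= m) by (apply Hm1; exists y; auto). lra. }
    assert (Hp : 0 < (h x + m) / 2) by lra.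
    destruct (Hh x Kx _ Hp) as [d [Hd H]].
    exists (Rmin d ((h x + m) / 2)). split; [apply Rmin_pos; lra|].
    intros y Ky Hy.
    assert (Hy' : Rabs (h y - h x) < (h x + m) / 2).
    { apply H; [exact Ky|]. eapply Rlt_le_trans; [exact Hy|apply Rmin_l]. }
    apply Rabs_lt_between in Hy'.
    generalize (Rmin_r d ((h x + m) / 2)). lra. }
  assert (m <= m - d); [|lra].
  apply Hm2. intros v [y [Ky ->]]. generalize (H y Ky). lra.
Qed.

(** * Connectedness of the unit interval *)

(** Let [m] be the supremum of the [t] such that [P] holds on [0, t]. Local constancy at [m] carries
    [P] to [m] and then beyond it, unless 1 has been passed. *)
Lemma unit_interval_connected (P : R -> Prop) :
  (forall t, 0 <= t <= 1 -> exists e, 0 < e /\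
     forall s, 0 <= s <= 1 -> Rabs (s - t) < e -> (P s <-> P t)) ->
  P 0 -> P 1.
Proof.
  intros Hloc P0.
  destruct (completeness (fun t => 0 <= t <= 1 /\
    forall s, 0 <= s <= t -> P s)) as [m [Hm1 Hm2]].
  { exists 1. intros t [Ht _]. lra. }
  { exists 0. split; [lra|]. intros s Hs. replace s with 0 by lra. exact P0. }
  assert (Hm0 : 0 <= m).
  { apply Hm1. split; [lra|]. intros s Hs. replace s with 0 by lra. exact P0. }
  assert (Hm3 : m <= 1) by (apply Hm2; intros t [Ht _]; lra).
  destruct (Hloc m (conj Hm0 Hm3)) as [e [He H]].
  assert (Ht : exists t, m - e < t <= m /\ 0 <= t <= 1 /\
    forall s, 0 <= s <= t -> P s).
  { apply NNPP. intros Hno. assert (m <= m - e); [|lra].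
    apply Hm2. intros t Ht. apply Rnot_lt_le. intros Hlt. apply Hno.
    exists t. split; [|exact Ht]. split; [exact Hlt|]. apply Hm1, Ht. }
  destruct Ht as [t [Ht1 [Ht2 Ht3]]].
  assert (Pm : P m).
  { apply (H t); [lra|apply Rabs_lt_between; lra|]. apply Ht3. lra. }
  assert (Hall : forall s, 0 <= s <= 1 -> s < m + e -> P s).
  { intros s Hs Hse. destruct (Rle_lt_dec s t) as [Hst|Hst].
    - apply Ht3. lra.
    - apply H; [exact Hs|apply Rabs_lt_between; lra|exact Pm]. }
  destruct (Rlt_le_dec 1 (m + e)) as [H1|H1]; [apply Hall; lra|].
  exfalso. assert (m + e / 2 <= m); [|lra].
  apply Hm1. split; [lra|]. intros s Hs. apply Hall; lra.
Qed.

(** If the value [c] were missed, the proposition [h t < c] would be locally constant and would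
    propagate from 0 to 1. *)
Lemma unit_interval_ivt (h : R -> R) (c : R) :
  (forall t, 0 <= t <= 1 -> forall e, 0 < e -> exists d, 0 < d /\
     forall s, 0 <= s <= 1 -> Rabs (s - t) < d -> Rabs (h s - h t) < e) ->
  h 0 <= c <= h 1 -> exists t, 0 <= t <= 1 /\ h t = c.
Proof.
  intros Hh Hc. apply NNPP. intros Hno.
  assert (H1 : h 1 < c).
  { apply (unit_interval_connected (fun t => h t < c)).
    - intros t Ht. assert (Hne : h t <> c) by (intros E; apply Hno; eauto).
      destruct (Hh t Ht (Rabs (h t - c))) as [d [Hd H]].
      { apply Rabs_pos_lt. lra. }
      exists d. split; [exact Hd|]. intros s Hs Hst.
      generalize (H s Hs Hst). unfold Rabs.
      destruct (Rcase_abs (h s - h t)), (Rcase_abs (h t - c)); lra.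
    - destruct (Req_dec (h 0) c) as [E|E]; [|lra].
      exfalso. apply Hno. exists 0. split; [lra|exact E]. }
  lra.
Qed.

(** * Absolutely convergent power series *)


Notation is_cseries u l :=
  (is_series (K := C_AbsRing) (V := C_NormedModule) u l).

Notation csum := (sum_n (G := C_AbelianMonoid)).

Definition summable (a : nat -> C) : Prop := ex_series (fun n => Cmod (a n)).

Definition l1norm (a : nat -> C) : R := Series (fun n => Cmod (a n)).

Definition cshift (k : nat) (a : nat -> C) (n : nat) : C := a (k + n)%nat.

(** The choice operator [iota] makes the sum a total function; it is the true sum as soon as the
    series converges, in particular for summable coefficients and [Cmod z <= 1]. *)
Definition CPS (a : nat -> C) (z : C) : C :=
  iota (T := C_CompleteNormedModule)
    (fun l => is_cseries (fun n => (a n * z ^ n)%C) l).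

Lemma is_cseries_unique (u : nat -> C) (l l' : C) :
  is_cseries u l -> is_cseries u l' -> l = l'.
Proof.
  exact (filterlim_locally_unique (V := C_NormedModule) (F := eventually) (csum u) l l').
Qed.

Lemma ex_cseries (u : nat -> C) : summable u -> exists l, is_cseries u l.
Proof.
  intros H.
  apply (ex_series_le (V := C_CompleteNormedModule) u (fun n => Cmod (u n)));
    [|exact H].
  intros n. apply Rle_refl.
Qed.

Lemma Cmod_csum_le (u : nat -> C) (N : nat) :
  Cmod (csum u N) <= sum_n (fun n => Cmod (u n)) N.
Proof.
  eapply Rle_trans; [apply (norm_sum_n_m (V := C_NormedModule))|].
  apply sum_n_m_le. intros k. apply Rle_refl.
Qed.

Lemma sum_n_le_Series (v : nat -> R) (N : nat) :
  (forall n, 0 <= v n) -> ex_series v -> sum_n v N <= Series v.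
Proof.
  intros Hv Hs.
  apply (is_lim_seq_incr_compare (sum_n v)).
  - exact (Series_correct v Hs).
  - intros n. rewrite sum_Sn. unfold plus; simpl. generalize (Hv (S n)). lra.
Qed.

Lemma is_cseries_eps (u : nat -> C) (l : C) (e : R) :
  is_cseries u l -> 0 < e ->
  exists N, forall n, (N <= n)%nat -> Cmod (csum u n - l)%C < e.
Proof.
  intros H He. assert (He2 : 0 < e / 2) by lra.
  destruct (H (fun y => Cmod (y - l)%C < e)) as [N HN].
  - exists (mkposreal _ He2). intros y Hy. apply Cmod_of_ball in Hy.
    simpl in Hy. lra.
  - exists N. exact HN.
Qed.

Lemma is_cseries_Cmod_le (u : nat -> C) (l : C) :
  summable u -> is_cseries u l -> Cmod l <= l1norm u.
Proof.
  intros Hs H. apply Rnot_lt_le. intros Hlt.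
  destruct (is_cseries_eps u l (Cmod l - l1norm u) H) as [N HN]; [lra|].
  generalize (HN N (le_n N)). rewrite Cmod_minus_sym.
  generalize (Cmod_triangle_rev l (csum u N)) (Cmod_csum_le u N)
    (sum_n_le_Series (fun n => Cmod (u n)) N (fun n => Cmod_ge_0 _) Hs).
  unfold l1norm in *. lra.
Qed.

Lemma Cmod_pow_le_1 (z : C) (n : nat) : Cmod z <= 1 -> Cmod (z ^ n)%C <= 1.
Proof.
  intros Hz. rewrite Cmod_pow. rewrite <- (pow1 n).
  apply pow_incr. split; [apply Cmod_ge_0|exact Hz].
Qed.

Lemma Cmod_term_le (a : nat -> C) (z : C) (n : nat) :
  Cmod z <= 1 -> Cmod (a n * z ^ n)%C <= Cmod (a n).
Proof.
  intros Hz. rewrite Cmod_mult.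
  generalize (Cmod_pow_le_1 z n Hz) (Cmod_ge_0 (a n)). nra.
Qed.

Lemma summable_le (a b : nat -> C) :
  (forall n, Cmod (a n) <= Cmod (b n)) -> summable b -> summable a.
Proof.
  intros H. apply (ex_series_le (V := R_CompleteNormedModule)).
  intros n. unfold norm; simpl. unfold abs; simpl.
  rewrite Rabs_pos_eq; [apply H|apply Cmod_ge_0].
Qed.

Lemma l1norm_le (a b : nat -> C) :
  (forall n, Cmod (a n) <= Cmod (b n)) -> summable b -> l1norm a <= l1norm b.
Proof.
  intros H Hb. apply Series_le; [|exact Hb].
  intros n. split; [apply Cmod_ge_0|apply H].
Qed.

Lemma l1norm_ge_0 (a : nat -> C) : summable a -> 0 <= l1norm a.
Proof.
  intros H.
  generalize (sum_n_le_Series (fun n => Cmod (a n)) 0 (fun n => Cmod_ge_0 _) H).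
  rewrite sum_O. generalize (Cmod_ge_0 (a 0%nat)). unfold l1norm. lra.
Qed.

Lemma summable_term (a : nat -> C) (z : C) :
  summable a -> Cmod z <= 1 -> summable (fun n => (a n * z ^ n)%C).
Proof.
  intros H Hz. apply (summable_le _ a); [|exact H].
  intros n. apply Cmod_term_le, Hz.
Qed.

Lemma CPS_unique (a : nat -> C) (z l : C) :
  is_cseries (fun n => (a n * z ^ n)%C) l -> CPS a z = l.
Proof.
  intros H. apply (iota_unique (V := C_CompleteNormedModule)); [|exact H].
  intros y Hy. exact (is_cseries_unique _ _ _ Hy H).
Qed.

Lemma CPS_correct (a : nat -> C) (z : C) :
  summable a -> Cmod z <= 1 -> is_cseries (fun n => (a n * z ^ n)%C) (CPS a z).
Proof.
  intros H Hz.
  destruct (ex_cseries _ (summable_term a z H Hz)) as [l Hl].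
  rewrite (CPS_unique _ _ _ Hl). exact Hl.
Qed.

Lemma CPS_Cmod_le (a : nat -> C) (z : C) :
  summable a -> Cmod z <= 1 -> Cmod (CPS a z) <= l1norm a.
Proof.
  intros H Hz. eapply Rle_trans.
  - apply (is_cseries_Cmod_le (fun n => (a n * z ^ n)%C)).
    + apply summable_term; assumption.
    + apply CPS_correct; assumption.
  - apply l1norm_le; [|exact H]. intros n. apply Cmod_term_le, Hz.
Qed.

Lemma summable_cshift (k : nat) (a : nat -> C) :
  summable a -> summable (cshift k a).
Proof.
  intros H. exact (proj1 (ex_series_incr_n (fun n => Cmod (a n)) k) H).
Qed.

Lemma summable_of_tail (a : nat -> C) : summable (cshift 1 a) -> summable a.
Proof.
  intros H. exact (proj2 (ex_series_incr_1 (fun n => Cmod (a n))) H).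
Qed.

Lemma l1norm_cshift_le (k : nat) (a : nat -> C) :
  summable a -> l1norm (cshift k a) <= l1norm a.
Proof.
  intros H. destruct k as [|k]; [apply Rle_refl|].
  unfold l1norm at 2. rewrite (Series_incr_n _ (S k)); [|lia|exact H].
  assert (0 <= sum_f_R0 (fun n => Cmod (a n)) (Init.Nat.pred (S k)));
    [|unfold l1norm, cshift; lra].
  apply cond_pos_sum. intros n. apply Cmod_ge_0.
Qed.

Lemma CPS_unfold (a : nat -> C) (z : C) :
  summable a -> Cmod z <= 1 ->
  CPS a z = (a 0%nat + z * CPS (cshift 1 a) z)%C.
Proof.
  intros H Hz. apply CPS_unique.
  apply (is_series_decr_1 (K := C_AbsRing) (V := C_NormedModule)).
  match goal with |- is_series _ ?l =>
    replace l with (scal (K := C_AbsRing) (V := C_NormedModule) z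
      (CPS (cshift 1 a) z)) end.
  - eapply is_series_ext;
      [|apply (is_series_scal (K := C_AbsRing) (V := C_NormedModule) z);
        apply CPS_correct; [apply summable_cshift, H|exact Hz]].
    intros n. unfold scal; simpl. unfold mult, cshift; simpl. ring.
  - unfold scal, plus, opp, mult; simpl.
    change ((z * CPS (cshift 1 a) z)%C = (a 0%nat + z * CPS (cshift 1 a) z
       + - (a 0%nat * 1))%C). ring.
Qed.

Lemma CPS_lin (a b : nat -> C) (c z : C) :
  summable a -> summable b -> Cmod z <= 1 ->
  CPS (fun n => (a n - c * b n)%C) z = (CPS a z - c * CPS b z)%C.
Proof.
  intros Ha Hb Hz. apply CPS_unique.
  eapply is_series_ext;
    [|apply (is_series_minus (K := C_AbsRing) (V := C_NormedModule));
      [apply (CPS_correct a z Ha Hz)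
      |apply (is_series_scal (K := C_AbsRing) (V := C_NormedModule) c);
       apply (CPS_correct b z Hb Hz)]].
  intros n. unfold scal, plus, opp, mult; simpl.
  change ((a n * z ^ n + - (c * (b n * z ^ n)))%C = ((a n - c * b n) * z ^ n)%C).
  ring.
Qed.

Lemma CPS_ext (a b : nat -> C) (z : C) :
  summable a -> Cmod z <= 1 -> (forall n, a n = b n) -> CPS b z = CPS a z.
Proof.
  intros Ha Hz H. apply CPS_unique. eapply is_series_ext;
    [|apply (CPS_correct a z Ha Hz)]. intros n. cbv beta. rewrite H. reflexivity.
Qed.

(** The bound is independent of [z]: the partial sums converge uniformly on the closed unit disk. *)
Lemma CPS_tail (a : nat -> C) (z : C) (N : nat) :
  summable a -> Cmod z <= 1 ->
  Cmod (CPS a z - csum (fun n => (a n * z ^ n)%C) N)%C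
    <= l1norm (cshift (S N) a).
Proof.
  intros H Hz.
  set (u := fun n => (a n * z ^ n)%C).
  assert (Hu : summable u) by (apply summable_term; assumption).
  eapply Rle_trans.
  - apply (is_cseries_Cmod_le (cshift (S N) u)).
    + apply summable_cshift, Hu.
    + apply (is_series_incr_n (K := C_AbsRing) (V := C_NormedModule) u (S N));
        [lia|].
      match goal with |- is_series _ ?l => replace l with (CPS a z) end.
      * apply CPS_correct; assumption.
      * unfold plus; simpl.
        change (CPS a z = (CPS a z - csum u N + csum u N)%C). ring.
  - apply l1norm_le; [|apply summable_cshift, H].
    intros n. unfold cshift, u. apply Cmod_term_le, Hz.
Qed.

Lemma l1norm_tail_small (a : nat -> C) (e : R) :
  summable a -> 0 < e ->
  exists N, forall n, (N <= n)%nat -> l1norm (cshift (S n) a) < e.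
Proof.
  intros H He.
  assert (L : is_lim_seq (sum_n (fun n => Cmod (a n))) (l1norm a))
    by exact (Series_correct _ H).
  apply is_lim_seq_spec in L. unfold l1norm at 1 in L.
  destruct (L (mkposreal e He)) as [N HN].
  exists N. intros n Hn. specialize (HN n Hn). simpl in HN.
  rewrite (Series_incr_n _ (S n)) in HN; [|lia|exact H].
  rewrite sum_n_Reals in HN. simpl Init.Nat.pred in HN.
  apply Rabs_lt_between in HN. unfold l1norm, cshift. lra.
Qed.

Lemma Cpow_lip (z w : C) (n : nat) :
  Cmod z <= 1 -> Cmod w <= 1 ->
  Cmod (z ^ n - w ^ n)%C <= INR n * Cmod (z - w)%C.
Proof.
  intros Hz Hw. induction n as [|n IH].
  - simpl. rewrite Cminus_diag, Cmod_0. lra.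
  - rewrite !Cpow_S, S_INR.
    replace (z * z ^ n - w * w ^ n)%C
      with (z * (z ^ n - w ^ n) + (z - w) * w ^ n)%C by ring.
    eapply Rle_trans; [apply Cmod_triangle|]. rewrite !Cmod_mult.
    generalize (Cmod_pow_le_1 w n Hw) (Cmod_ge_0 (z - w)%C) (Cmod_ge_0 z)
      (Cmod_ge_0 (z ^ n - w ^ n)%C). nra.
Qed.

Lemma csum_lip (a : nat -> C) (N : nat) :
  exists L, 0 <= L /\ forall z w, Cmod z <= 1 -> Cmod w <= 1 ->
    Cmod (csum (fun n => (a n * z ^ n)%C) N -
          csum (fun n => (a n * w ^ n)%C) N)%C <= L * Cmod (z - w)%C.
Proof.
  induction N as [|N [L [HL IH]]].
  - exists 0. split; [lra|]. intros z w _ _. rewrite !sum_O. simpl.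
    rewrite Cminus_diag, Cmod_0. lra.
  - exists (L + Cmod (a (S N)) * INR (S N)). split.
    { generalize (Cmod_ge_0 (a (S N))) (pos_INR (S N)). nra. }
    intros z w Hz Hw. rewrite !sum_Sn. unfold plus; simpl plus.
    change (Cmod (csum (fun n => a n * z ^ n)%C N + a (S N) * z ^ S N
      - (csum (fun n => a n * w ^ n)%C N + a (S N) * w ^ S N))%C
      <= (L + Cmod (a (S N)) * INR (S N)) * Cmod (z - w)%C).
    match goal with |- Cmod (?x + ?a * ?p - (?y + ?a * ?q))%C <= _ =>
      replace (x + a * p - (y + a * q))%C with ((x - y) + a * (p - q))%C by ring
    end.
    eapply Rle_trans; [apply Cmod_triangle|]. rewrite Cmod_mult.
    generalize (IH z w Hz Hw) (Cpow_lip z w (S N) Hz Hw) (Cmod_ge_0 (a (S N))).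
    nra.
Qed.

Lemma CPS_continuous (a : nat -> C) :
  summable a -> forall z e, Cmod z <= 1 -> 0 < e -> exists d, 0 < d /\
    forall w, Cmod w <= 1 -> Cmod (w - z)%C < d ->
      Cmod (CPS a w - CPS a z)%C < e.
Proof.
  intros H z e Hz He.
  destruct (l1norm_tail_small a (e / 4) H) as [N HN]; [lra|].
  specialize (HN N (le_n N)).
  destruct (csum_lip a N) as [L [HL HLip]].
  (* Two tails and the Lipschitz variation of the partial sum each cost at most [e / 4]; [L + 1]
     avoids a division by zero. *)
  exists (e / 4 / (L + 1)). split; [apply Rdiv_lt_0_compat; lra|].
  intros w Hw Hd.
  generalize (CPS_tail a z N H Hz) (CPS_tail a w N H Hw) (HLip w z Hw Hz).
  set (sz := csum (fun n => (a n * z ^ n)%C) N).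
  set (sw := csum (fun n => (a n * w ^ n)%C) N).
  intros H1 H2 H3.
  assert (H4 : L * Cmod (w - z)%C <= e / 4).
  { apply (Rmult_lt_compat_r (L + 1)) in Hd; [|lra].
    replace (e / 4 / (L + 1) * (L + 1)) with (e / 4) in Hd by (field; lra).
    generalize (Cmod_ge_0 (w - z)%C). nra. }
  generalize (Cmod_minus_triangle (CPS a w) sw (CPS a z))
    (Cmod_minus_triangle sw sz (CPS a z)).
  rewrite (Cmod_minus_sym sz (CPS a z)). lra.
Qed.

(* Coefficients of the quotient of [CPS a z - CPS a z0] by [z - z0]. *)
Definition quot_coef (a : nat -> C) (z0 : C) (m : nat) : C :=
  CPS (cshift (S m) a) z0.

(** This is the recurrence of synthetic division by [z - z0]. It yields both the summability of the
    quotient and the division identity, without any double series. *)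
Lemma quot_coef_rec (a : nat -> C) (z0 : C) (m : nat) :
  summable a -> Cmod z0 <= 1 ->
  quot_coef a z0 m = (a (S m) + z0 * quot_coef a z0 (S m))%C.
Proof.
  intros H Hz. unfold quot_coef. rewrite CPS_unfold;
    [|apply summable_cshift, H|exact Hz].
  f_equal; [unfold cshift; f_equal; lia|]. f_equal.
  apply CPS_ext; [apply summable_cshift, H|exact Hz|].
  intros n. unfold cshift. f_equal. lia.
Qed.

Lemma ex_series_bounded (v : nat -> R) (M : R) :
  (forall n, 0 <= v n) -> (forall n, sum_n v n <= M) ->
  ex_series v /\ Series v <= M.
Proof.
  intros Hv HM.
  assert (He : ex_finite_lim_seq (sum_n v)).
  { apply (ex_finite_lim_seq_incr _ M); [|exact HM].
    intros n. rewrite sum_Sn. unfold plus; simpl. generalize (Hv (S n)). lra. }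
  destruct He as [l Hl].
  assert (Hs : is_series v l) by exact Hl.
  split; [exists l; exact Hs|]. rewrite (is_series_unique _ _ Hs).
  apply (is_lim_seq_le _ (fun _ => M) l M HM Hl). apply is_lim_seq_const.
Qed.

Lemma quot_coef_summable (a : nat -> C) (z0 : C) :
  summable a -> Cmod z0 < 1 ->
  summable (quot_coef a z0) /\
  l1norm (quot_coef a z0) <= 2 / (1 - Cmod z0) * l1norm a.
Proof.
  intros H Hz. apply ex_series_bounded; [intros n; apply Cmod_ge_0|].
  intros N. set (r := Cmod z0) in *.
  assert (Hr : 0 <= r) by apply Cmod_ge_0.
  assert (Hq : forall m, Cmod (quot_coef a z0 m) <= l1norm a).
  { intros m. eapply Rle_trans;
      [apply CPS_Cmod_le; [apply summable_cshift, H|fold r; lra]|].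
    apply l1norm_cshift_le, H. }
  (* Taking moduli in the recurrence and summing, the terms [r * Cmod (quot_coef a z0 n)] on the
     right are absorbed on the left up to the two end terms. The last of these is at most
     [l1norm a], which explains the constant 2. *)
  assert (Hrec : forall M, sum_n (fun n => Cmod (quot_coef a z0 n)) M * (1 - r)
    <= sum_n (fun n => Cmod (cshift 1 a n)) M + r * Cmod (quot_coef a z0 (S M))
       - r * Cmod (quot_coef a z0 0)).
  { intros M.
    assert (Hstep : forall m, Cmod (quot_coef a z0 m) <=
      Cmod (cshift 1 a m) + r * Cmod (quot_coef a z0 (S m))).
    { intros m. rewrite quot_coef_rec; [|exact H|fold r; lra].
      eapply Rle_trans; [apply Cmod_triangle|]. rewrite Cmod_mult.
      unfold cshift. simpl. fold r. lra. }
    induction M as [|M IH].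
    - rewrite !sum_O. generalize (Hstep 0%nat). lra.
    - rewrite !sum_Sn. unfold plus; simpl. generalize (Hstep (S M)). lra. }
  generalize (Hrec N) (Hq (S N)) (Cmod_ge_0 (quot_coef a z0 0))
    (sum_n_le_Series (fun n => Cmod (cshift 1 a n)) N (fun n => Cmod_ge_0 _)
      (summable_cshift 1 a H)) (l1norm_cshift_le 1 a H) (l1norm_ge_0 a H).
  set (s := sum_n (fun n => Cmod (quot_coef a z0 n)) N).
  set (s' := sum_n (fun n => Cmod (cshift 1 a n)) N).
  unfold l1norm in *.
  set (T := Series (fun n => Cmod (a n))) in *.
  set (T' := Series (fun n => Cmod (cshift 1 a n))) in *.
  intros H1 H2 H3 H4 H5 H6.
  assert (s * (1 - r) <= 2 * T) by nra.
  apply (Rmult_le_reg_r (1 - r)); [lra|].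
  replace (2 / (1 - r) * T * (1 - r)) with (2 * T) by (field; lra). assumption.
Qed.

Lemma CPS_quot (a : nat -> C) (z0 z : C) :
  summable a -> Cmod z0 < 1 -> Cmod z <= 1 ->
  CPS a z = (CPS a z0 + (z - z0) * CPS (quot_coef a z0) z)%C.
Proof.
  intros H Hz0 Hz.
  destruct (quot_coef_summable a z0 H Hz0) as [Hq _].
  assert (H0 : Cmod z0 <= 1) by lra.
  rewrite (CPS_unfold a z H Hz), (CPS_unfold a z0 H H0).
  (* By the recurrence, the shifted coefficients of [a] are those of the quotient minus [z0] times
     its shift. *)
  replace (CPS (cshift 1 a) z) with
    (CPS (quot_coef a z0) z - z0 * CPS (cshift 1 (quot_coef a z0)) z)%C.
  - rewrite (CPS_unfold (quot_coef a z0) z Hq Hz).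
    change (CPS (cshift 1 a) z0) with (quot_coef a z0 0). ring.
  - rewrite <- CPS_lin;
      [|exact Hq|apply summable_cshift, Hq|exact Hz].
    apply CPS_ext; [apply summable_cshift, H|exact Hz|].
    intros n. unfold cshift at 2. rewrite (quot_coef_rec a z0 n H H0).
    unfold cshift. simpl. ring.
Qed.

(* The quotients have l1-norms growing at most geometrically, so infinitely
   many divisions by [z - z0] force the series to vanish near z0. *)
Lemma CPS_order (a : nat -> C) (z0 : C) :
  summable a -> Cmod z0 < 1 ->
  (exists e, 0 < e /\
     forall z, Cmod z <= 1 -> Cmod (z - z0)%C < e -> CPS a z = 0%C) \/
  (exists k b, summable b /\ CPS b z0 <> 0%C /\
     forall z, Cmod z <= 1 -> CPS a z = ((z - z0) ^ k * CPS b z)%C).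
Proof.
  intros H Hz0.
  destruct (classic (exists k b, summable b /\ CPS b z0 <> 0%C /\
     forall z, Cmod z <= 1 -> CPS a z = ((z - z0) ^ k * CPS b z)%C))
    as [Hex|Hno]; [right; exact Hex|left].
  set (D := 2 / (1 - Cmod z0)).
  assert (HD : 0 < D) by (apply Rdiv_lt_0_compat; lra).
  assert (Hk : forall k, exists b, summable b /\ l1norm b <= D ^ k * l1norm a /\
    forall z, Cmod z <= 1 -> CPS a z = ((z - z0) ^ k * CPS b z)%C).
  { induction k as [|k [b [Hb [Hn Hf]]]].
    - exists a. split; [exact H|]. split; [simpl; lra|].
      intros z _. simpl. ring.
    - assert (Hb0 : CPS b z0 = 0%C).
      { apply NNPP. intros Hne. apply Hno. exists k, b. auto. }
      exists (quot_coef b z0).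
      destruct (quot_coef_summable b z0 Hb Hz0) as [Hq Hqn].
      split; [exact Hq|]. split.
      + eapply Rle_trans; [exact Hqn|]. fold D. simpl.
        rewrite Rmult_assoc. apply Rmult_le_compat_l; [lra|exact Hn].
      + intros z Hz. rewrite (Hf z Hz), (CPS_quot b z0 z Hb Hz0 Hz), Hb0.
        rewrite Cpow_S. ring. }
  (* Within this radius [Cmod (z - z0) * D] is below 1/2, so the factor from the [k] divisions beats
     the growth [D ^ k] of the norms. *)
  exists (/ (2 * D)). split; [apply Rinv_0_lt_compat; lra|].
  intros z Hz Hd. apply Cmod_eq_0.
  set (q := Cmod (z - z0)%C * D).
  assert (Hq0 : 0 <= q) by (generalize (Cmod_ge_0 (z - z0)%C); unfold q; nra).
  assert (Hq : q < 1 / 2).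
  { apply (Rmult_lt_compat_r D) in Hd; [|lra].
    replace (/ (2 * D) * D) with (1 / 2) in Hd by (field; lra). exact Hd. }
  apply Rle_antisym; [|apply Cmod_ge_0].
  assert (Hb : forall k, Cmod (CPS a z) <= q ^ k * l1norm a).
  { intros k. destruct (Hk k) as [b [Hb [Hn Hf]]].
    rewrite (Hf z Hz), Cmod_mult, Cmod_pow. unfold q.
    rewrite Rpow_mult_distr, Rmult_assoc.
    apply Rmult_le_compat_l; [apply pow_le, Cmod_ge_0|].
    eapply Rle_trans; [apply CPS_Cmod_le; assumption|exact Hn]. }
  assert (HL : is_lim_seq (fun k => q ^ k * l1norm a) (0 * l1norm a)).
  { apply (is_lim_seq_scal_r _ _ 0). apply is_lim_seq_geom.
    rewrite Rabs_pos_eq; lra. }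
  rewrite Rmult_0_l in HL.
  exact (is_lim_seq_le _ _ _ _ Hb (is_lim_seq_const _) HL).
Qed.

(** * Roots of unity and modulus descent *)


Lemma Cmod_sqr (z : C) : Cmod z ^ 2 = fst z ^ 2 + snd z ^ 2.
Proof. exact (Cmod2_alt z). Qed.

Lemma Cmod_cis (t : R) : Cmod (cis t) = 1.
Proof.
  unfold cis, Cmod; simpl fst; simpl snd.
  replace (cos t ^ 2 + sin t ^ 2) with 1 by (rewrite <- (sin2_cos2 t); unfold Rsqr; ring).
  apply sqrt_1.
Qed.

Lemma cis_plus (s t : R) : cis (s + t) = (cis s * cis t)%C.
Proof.
  unfold cis, Cmult; simpl. rewrite cos_plus, sin_plus. f_equal; ring.
Qed.

Lemma cis_pow (t : R) (n : nat) : (cis t ^ n)%C = cis (INR n * t).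
Proof.
  induction n as [|n IH].
  - simpl. rewrite Rmult_0_l. unfold cis. rewrite cos_0, sin_0. reflexivity.
  - rewrite Cpow_S, IH, <- cis_plus, S_INR. f_equal. ring.
Qed.

Lemma cis_2PI_nat (k : nat) : cis (INR k * (2 * PI)) = 1%C.
Proof.
  unfold cis, RtoC. replace (INR k * (2 * PI)) with (0 + 2 * INR k * PI) by ring.
  rewrite cos_period, sin_period, cos_0, sin_0. reflexivity.
Qed.

Lemma cis_neq_1 (t : R) : 0 < t < 2 * PI -> cis t <> 1%C.
Proof.
  intros Ht E. apply (f_equal fst) in E. simpl in E.
  replace t with (2 * (t / 2)) in E by field. rewrite cos_2a_sin in E.
  assert (0 < sin (t / 2)) by (apply sin_gt_0; lra). nra.
Qed.

Lemma unit_cis (z : C) : Cmod z = 1 -> exists t, z = cis t.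
Proof.
  intros H. assert (H2 := Cmod_sqr z). rewrite H in H2.
  destruct z as [x y]; simpl in *.
  assert (Hx : -1 <= x <= 1) by nra.
  assert (Hs : sin (acos x) = Rabs y).
  { rewrite sin_acos; [|exact Hx].
    rewrite <- sqrt_Rsqr_abs. f_equal. unfold Rsqr. lra. }
  destruct (Rle_lt_dec 0 y) as [Hy|Hy].
  - exists (acos x). unfold cis. rewrite cos_acos, Hs, Rabs_pos_eq; auto.
  - exists (- acos x). unfold cis.
    rewrite cos_neg, sin_neg, cos_acos, Hs, Rabs_left; auto. f_equal. ring.
Qed.

Lemma unit_root (z : C) (k : nat) :
  Cmod z = 1 -> (1 <= k)%nat -> exists d, Cmod d = 1 /\ (d ^ k)%C = z.
Proof.
  intros Hz Hk. destruct (unit_cis z Hz) as [t ->].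
  exists (cis (t / INR k)). split; [apply Cmod_cis|].
  rewrite cis_pow. f_equal. field. apply not_0_INR. lia.
Qed.

Lemma csum_Sn (u : nat -> C) (N : nat) :
  csum u (S N) = (csum u N + u (S N))%C :> C.
Proof. exact (sum_Sn (G := C_AbelianMonoid) u N). Qed.

Lemma csum_geom (q : C) (N : nat) :
  ((q - 1) * csum (fun j => (q ^ j)%C) N = q ^ S N - 1)%C.
Proof.
  induction N as [|N IH].
  - rewrite sum_O. simpl. ring.
  - rewrite csum_Sn, Cmult_plus_distr_l, IH, (Cpow_S q (S N)). ring.
Qed.

(** A geometric sum whose ratio [q] satisfies [q ^ S N = 1], while [q] differs from 1 because 0 < n
    < N + 1. *)
Lemma csum_roots_of_unity (N n : nat) :
  (1 <= n <= N)%nat ->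
  csum (fun j => (cis (INR j * (2 * PI / INR (S N))) ^ n)%C) N = RtoC 0 :> C.
Proof.
  intros Hn.
  assert (HN : 0 < INR (S N)) by (apply lt_0_INR; lia).
  set (q := cis (INR n * (2 * PI / INR (S N)))).
  rewrite (sum_n_ext (G := C_AbelianMonoid) _ (fun j => (q ^ j)%C)).
  - assert (Hq : (q - 1)%C <> 0%C).
    { intros E. apply (cis_neq_1 (INR n * (2 * PI / INR (S N)))).
      - assert (0 < INR n) by (apply lt_0_INR; lia).
        assert (INR n < INR (S N)) by (apply lt_INR; lia).
        assert (HP := PI_RGT_0).
        replace (INR n * (2 * PI / INR (S N)))
          with ((INR n / INR (S N)) * (2 * PI)) by (field; lra).
        assert (0 < INR n / INR (S N)) by (apply Rdiv_lt_0_compat; lra).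
        assert (INR n / INR (S N) < 1).
        { apply (Rmult_lt_reg_r (INR (S N))); [lra|].
          unfold Rdiv. rewrite Rmult_assoc, Rinv_l; lra. }
        nra.
      - fold q. replace q with ((q - 1) + 1)%C by ring. rewrite E. ring. }
    assert (G := csum_geom q N).
    replace (q ^ S N)%C with (RtoC 1) in G.
    + replace (1 - 1)%C with (RtoC 0) in G by ring.
      destruct (Ceq_dec (csum (fun j => (q ^ j)%C) N) 0) as [E|E]; [exact E|].
      destruct (Cmult_neq_0 _ _ Hq E G).
    + unfold q. rewrite cis_pow, <- (cis_2PI_nat n). f_equal. field. lra.
  - intros j. unfold q. rewrite !cis_pow. f_equal. ring.
Qed.

Lemma csum_const (c : C) (N : nat) : csum (fun _ => c) N = (INR (S N) * c)%C :> C.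
Proof.
  induction N as [|N IH].
  - rewrite sum_O. simpl. ring.
  - rewrite csum_Sn, IH, (S_INR (S N)), RtoC_plus. ring.
Qed.

(** A discrete mean value property: averaging the partial sum of order [N] over the roots of unity
    of order [N + 1] leaves [a 0]. On the unit circle these partial sums are small, being opposite
    to tails. *)
Lemma CPS_constant_term (a : nat -> C) :
  summable a -> (forall z, Cmod z = 1 -> CPS a z = 0%C) -> a 0%nat = 0%C.
Proof.
  intros H Hz. apply Cmod_eq_0. apply Rle_antisym; [|apply Cmod_ge_0].
  apply Rle_plus_epsilon. intros e He. rewrite Rplus_0_l.
  destruct (l1norm_tail_small a e H He) as [N HN]. specialize (HN N (le_n N)).
  assert (HN1 : 0 < INR (S N)) by (apply lt_0_INR; lia).
  set (z := fun j => cis (INR j * (2 * PI / INR (S N)))).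
  assert (Hsum : csum (fun j => csum (fun n => (a n * z j ^ n)%C) N) N
     = (INR (S N) * a 0%nat)%C :> C).
  { rewrite (sum_n_switch (G := C_AbelianMonoid)).
    rewrite <- csum_const.
    assert (Hk : forall k, (k <= N)%nat ->
      csum (fun n => csum (fun j => (a n * z j ^ n)%C) N) k
      = csum (fun _ => a 0%nat) N :> C).
    { induction k as [|k IH]; intros Hk.
      - rewrite sum_O. apply sum_n_ext. intros j. simpl. ring.
      - rewrite csum_Sn, IH; [|lia].
        transitivity (csum (fun _ => a 0%nat) N + a (S k) *
          csum (fun j => (z j ^ S k)%C) N)%C.
        + f_equal. apply (sum_n_mult_l (K := C_Ring)).
        + unfold z. rewrite csum_roots_of_unity; [ring|lia]. }
    apply Hk. lia. }
  assert (Hle : Cmod (INR (S N) * a 0%nat)%C <= INR (S N) * e).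
  { rewrite <- Hsum. eapply Rle_trans; [apply Cmod_csum_le|].
    rewrite <- sum_n_const. apply sum_n_m_le. intros j.
    assert (Hj : Cmod (z j) = 1) by apply Cmod_cis.
    generalize (CPS_tail a (z j) N H (Req_le _ _ Hj)).
    rewrite (Hz _ Hj). unfold Cminus. rewrite Cplus_0_l, Cmod_opp.
    intros Hle. eapply Rle_trans; [exact Hle|]. lra. }
  rewrite Cmod_mult, Cmod_R, Rabs_pos_eq in Hle; [|lra].
  apply (Rmult_le_reg_l (INR (S N))); assumption.
Qed.

(* Moving along the direction d with d^k E(z0) a negative multiple of D
   decreases the modulus of D + (z - z0)^k E(z). *)
Lemma modulus_descent (E : C -> C) (z0 D : C) (k : nat) (r : R) :
  0 < r -> (1 <= k)%nat -> D <> 0%C -> E z0 <> 0%C ->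
  (forall e, 0 < e -> exists d, 0 < d /\
     forall z, Cmod (z - z0)%C < d -> Cmod (E z - E z0)%C < e) ->
  exists z, Cmod (z - z0)%C < r /\ Cmod (D + (z - z0) ^ k * E z)%C < Cmod D.
Proof.
  intros Hr Hk HD HE Hcont.
  assert (HDp := proj1 (Cmod_gt_0 D) HD).
  assert (HEp := proj1 (Cmod_gt_0 _) HE).
  set (s := Cmod (E z0) / Cmod D).
  assert (Hs : 0 < s) by (apply Rdiv_lt_0_compat; assumption).
  (* The scale [s] is chosen so that this number has modulus 1; then [d ^ k * E z0] equals
     [- (s * D)]. *)
  destruct (unit_root (- (s * D) / E z0)%C k) as [d [Hd1 Hdk]]; [|exact Hk|].
  { rewrite Cmod_div, Cmod_opp, Cmod_mult, Cmod_R, Rabs_pos_eq; try lra.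
    - unfold s. field. lra.
    - exact HE. }
  assert (Hdk' : (d ^ k * E z0)%C = (- (s * D))%C)
    by (rewrite Hdk; field; exact HE).
  assert (Hp : 0 < s * Cmod D / 2) by (apply Rdiv_lt_0_compat; [nra|lra]).
  destruct (Hcont _ Hp) as [del [Hdel Hc]].
  (* The four bounds keep the point within [r], keep [E] close to [E z0], give [e ^ k <= e], and
     give [s * e ^ k < 1]. *)
  set (e := Rmin (Rmin (r / 2) (del / 2)) (Rmin 1 (/ (2 * s)))).
  assert (He : 0 < e).
  { unfold e. repeat apply Rmin_pos; try lra. apply Rinv_0_lt_compat. lra. }
  assert (He1 : e <= r / 2)
    by (unfold e; eapply Rle_trans; [apply Rmin_l|apply Rmin_l]).
  assert (He2 : e <= del / 2)
    by (unfold e; eapply Rle_trans; [apply Rmin_l|apply Rmin_r]).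
  assert (He3 : e <= 1)
    by (unfold e; eapply Rle_trans; [apply Rmin_r|apply Rmin_l]).
  assert (He4 : e <= / (2 * s))
    by (unfold e; eapply Rle_trans; [apply Rmin_r|apply Rmin_r]).
  assert (Hek : e ^ k <= e).
  { destruct k as [|k]; [lia|]. simpl.
    assert (e ^ k <= 1) by (rewrite <- (pow1 k); apply pow_incr; lra).
    nra. }
  assert (Hek0 : 0 < e ^ k) by (apply pow_lt; exact He).
  assert (Hsek : s * e ^ k < 1).
  { assert (s * (/ (2 * s)) = 1 / 2) by (field; lra). nra. }
  exists (z0 + e * d)%C.
  replace (z0 + e * d - z0)%C with (e * d)%C by ring.
  assert (Hm : Cmod (e * d)%C = e)
    by (rewrite Cmod_mult, Hd1, Cmod_R, Rabs_pos_eq; lra).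
  rewrite Hm. split; [lra|].
  assert (Hc' : Cmod (E (z0 + e * d)%C - E z0)%C < s * Cmod D / 2).
  { apply Hc. replace (z0 + e * d - z0)%C with (e * d)%C by ring. lra. }
  (* The main term has modulus (1 - s e^k) |D|, and the variation of [E] gives back at most half of
     the gain s e^k |D|. *)
  replace (D + (e * d) ^ k * E (z0 + e * d))%C with
    (D * (1 - s * e ^ k)%R + (e * d) ^ k * (E (z0 + e * d) - E z0))%C.
  - eapply Rle_lt_trans; [apply Cmod_triangle|].
    rewrite !Cmod_mult, Cmod_R, Cmod_pow, Hm, Rabs_pos_eq; [|lra].
    apply (Rmult_lt_compat_l (e ^ k)) in Hc'; [|exact Hek0]. nra.
  - rewrite Cpow_mult_l, <- !RtoC_pow.
    replace (RtoC (1 - s * e ^ k)) with (1 - s * e ^ k)%C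
      by (rewrite RtoC_minus, RtoC_mult, RtoC_pow; reflexivity).
    rewrite RtoC_pow.
    transitivity (D - e ^ k * (s * D) + e ^ k * (d ^ k * E (z0 + e * d))
       - e ^ k * (d ^ k * E z0))%C; [ring|].
    rewrite Hdk'. ring.
Qed.

(** * The conformal map near the unit circle *)


Definition cont_at (K : C -> Prop) (g : C -> C) (z : C) : Prop :=
  forall e, 0 < e -> exists d, 0 < d /\
    forall w, K w -> Cmod (w - z)%C < d -> Cmod (g w - g z)%C < e.

Lemma cont_at_const (K : C -> Prop) (c z : C) : cont_at K (fun _ => c) z.
Proof.
  intros e He. exists 1. split; [lra|]. intros w _ _.
  rewrite Cminus_diag, Cmod_0. exact He.
Qed.

Lemma cont_at_id (K : C -> Prop) (z : C) : cont_at K (fun w => w) z.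
Proof. intros e He. exists e. auto. Qed.

Lemma cont_at_plus (K : C -> Prop) (g h : C -> C) (z : C) :
  cont_at K g z -> cont_at K h z -> cont_at K (fun w => (g w + h w)%C) z.
Proof.
  intros Hg Hh e He.
  destruct (Hg (e / 2)) as [d1 [Hd1 H1]]; [lra|].
  destruct (Hh (e / 2)) as [d2 [Hd2 H2]]; [lra|].
  exists (Rmin d1 d2). split; [apply Rmin_pos; assumption|]. intros w Kw Hw.
  replace (g w + h w - (g z + h z))%C with ((g w - g z) + (h w - h z))%C by ring.
  eapply Rle_lt_trans; [apply Cmod_triangle|].
  generalize (H1 w Kw (Rlt_le_trans _ _ _ Hw (Rmin_l _ _)))
    (H2 w Kw (Rlt_le_trans _ _ _ Hw (Rmin_r _ _))). lra.
Qed.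

Lemma cont_at_mult (K : C -> Prop) (g h : C -> C) (z : C) :
  cont_at K g z -> cont_at K h z -> cont_at K (fun w => (g w * h w)%C) z.
Proof.
  intros Hg Hh e He.
  assert (Hgp := Cmod_ge_0 (g z)). assert (Hhp := Cmod_ge_0 (h z)).
  assert (E1 : 0 < e / 2 / (Cmod (h z) + 1))
    by (apply Rdiv_lt_0_compat; lra).
  assert (E2 : 0 < e / 2 / (Cmod (g z) + 1))
    by (apply Rdiv_lt_0_compat; lra).
  destruct (Hg _ E1) as [d1 [Hd1 H1]].
  destruct (Hh _ E2) as [d2 [Hd2 H2]].
  destruct (Hh 1 Rlt_0_1) as [d3 [Hd3 H3]].
  exists (Rmin d1 (Rmin d2 d3)).
  split; [repeat apply Rmin_pos; assumption|]. intros w Kw Hw.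
  assert (W1 := H1 w Kw (Rlt_le_trans _ _ _ Hw (Rmin_l _ _))).
  assert (Hw' := Rlt_le_trans _ _ _ Hw (Rmin_r _ _)).
  assert (W2 := H2 w Kw (Rlt_le_trans _ _ _ Hw' (Rmin_l _ _))).
  assert (W3 := H3 w Kw (Rlt_le_trans _ _ _ Hw' (Rmin_r _ _))).
  replace (g w * h w - g z * h z)%C
    with ((g w - g z) * h w + g z * (h w - h z))%C by ring.
  eapply Rle_lt_trans; [apply Cmod_triangle|]. rewrite !Cmod_mult.
  assert (W4 : Cmod (h w) < Cmod (h z) + 1)
    by (generalize (Cmod_triangle_rev (h w) (h z)); lra).
  assert (A1 : Cmod (g w - g z)%C * Cmod (h w) <= e / 2).
  { replace (e / 2) with (e / 2 / (Cmod (h z) + 1) * (Cmod (h z) + 1))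
      by (field; lra).
    apply Rmult_le_compat; try apply Cmod_ge_0; lra. }
  assert (A2 : Cmod (g z) * Cmod (h w - h z)%C < e / 2).
  { replace (e / 2) with ((Cmod (g z) + 1) * (e / 2 / (Cmod (g z) + 1)))
      by (field; lra).
    generalize (Cmod_ge_0 (h w - h z)%C). nra. }
  lra.
Qed.

Lemma cont_at_inv (K : C -> Prop) (z : C) : z <> 0%C -> cont_at K Cinv z.
Proof.
  intros Hz e He. assert (Hp := proj1 (Cmod_gt_0 z) Hz).
  (* The first bound keeps |w| above |z|/2; the second then controls |z - w| / (|w| |z|). *)
  exists (Rmin (Cmod z / 2) (e * Cmod z * Cmod z / 2)). split.
  { apply Rmin_pos; [lra|]. apply Rdiv_lt_0_compat; [|lra].
    repeat apply Rmult_lt_0_compat; assumption. }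
  intros w _ Hw.
  assert (W1 := Rlt_le_trans _ _ _ Hw (Rmin_l _ _)).
  assert (W2 := Rlt_le_trans _ _ _ Hw (Rmin_r _ _)).
  assert (W3 : Cmod z / 2 < Cmod w).
  { generalize (Cmod_triangle_rev z w). rewrite Cmod_minus_sym. lra. }
  assert (Hw0 : w <> 0%C) by (apply Cmod_gt_0; lra).
  replace (/ w - / z)%C with ((z - w) / (w * z))%C by (field; auto).
  rewrite Cmod_div, Cmod_mult, Cmod_minus_sym; [|apply Cmult_neq_0; assumption].
  apply (Rmult_lt_reg_r (Cmod w * Cmod z)); [nra|].
  unfold Rdiv. rewrite Rmult_assoc, Rinv_l, Rmult_1_r; [|nra].
  eapply Rlt_le_trans; [exact W2|].
  assert (0 < e * Cmod z) by (apply Rmult_lt_0_compat; lra). nra.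
Qed.

Lemma cont_at_comp (K L : C -> Prop) (g h : C -> C) (z : C) :
  (forall w, K w -> L (h w)) -> cont_at K h z -> cont_at L g (h z) ->
  cont_at K (fun w => g (h w)) z.
Proof.
  intros HKL Hh Hg e He. destruct (Hg e He) as [d [Hd H]].
  destruct (Hh d Hd) as [d' [Hd' H']]. exists d'. split; [exact Hd'|]. auto.
Qed.

Lemma cont_at_sub (K L : C -> Prop) (g : C -> C) (z : C) :
  (forall w, K w -> L w) -> cont_at L g z -> cont_at K g z.
Proof.
  intros HKL Hg e He. destruct (Hg e He) as [d [Hd H]].
  exists d. split; [exact Hd|]. auto.
Qed.

Lemma cont_at_CPS (a : nat -> C) (z : C) :
  summable a -> Cmod z <= 1 -> cont_at (fun w => Cmod w <= 1) (CPS a) z.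
Proof. intros H Hz e He. exact (CPS_continuous a H z e Hz He). Qed.

Lemma eps_cont_on_dist (K : C -> Prop) (g : C -> C) (x : C) :
  (forall z, K z -> cont_at K g z) -> eps_cont_on K (fun z => Cmod (g z - x)%C).
Proof.
  intros H z Kz e He. destruct (H z Kz e He) as [d [Hd Hg]].
  exists d. split; [exact Hd|]. intros w Kw Hw.
  eapply Rle_lt_trans; [|exact (Hg w Kw Hw)].
  generalize (Cmod_minus_triangle (g w) (g z) x)
    (Cmod_minus_triangle (g z) (g w) x).
  rewrite (Cmod_minus_sym (g z) (g w)).
  intros H1 H2. apply Rabs_le. lra.
Qed.

(** Serves for closed annuli, for circles when [r = s], and for closed disks when [r = 0]. *)
Lemma annulus_uniformizing (x : C) (r s : R) :
  uniformizing (fun z => r <= Cmod (z - x)%C <= s).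
Proof.
  apply closed_bounded_uniformizing.
  - intros z Hz.
    destruct (Rlt_le_dec (Cmod (z - x)%C) r) as [H|H].
    + exists (r - Cmod (z - x)%C). split; [lra|]. intros y Hy.
      generalize (Cmod_minus_triangle y z x). lra.
    + exists (Cmod (z - x)%C - s). split; [lra|]. intros y Hy.
      generalize (Cmod_minus_triangle z y x). rewrite (Cmod_minus_sym z y). lra.
  - exists (s + Cmod x). intros y Hy. generalize (Cmod_triangle_rev y x). lra.
Qed.

(** In the coordinate 1/z the negative powers form a power series on the closed unit disk. A zero
    coefficient is put in front, since [c n] belongs to the power n + 1 of 1/z. *)
Lemma laurent_expansion_CPS (f : C -> C) :
  laurent_expansion f -> exists (c1 : C) (u : nat -> C), c1 <> 0%C /\ summable u /\
    forall z, Omega_bar z -> f z = (c1 * z + CPS u (/ z))%C.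
Proof.
  intros [c1 [c [Hc1 [Hc Hf]]]].
  exists c1, (fun n => match n with O => RtoC 0 | S m => c m end).
  split; [exact Hc1|]. split.
  { apply summable_of_tail. exact Hc. }
  intros z Hz.
  assert (Hz0 : z <> 0%C)
    by (apply Cmod_gt_0; unfold Omega_bar in Hz; lra).
  rewrite (CPS_unique _ _ (f z - c1 * z)%C); [ring|].
  apply (is_series_decr_1 (K := C_AbsRing) (V := C_NormedModule)).
  match goal with |- is_series _ ?l => replace l with (f z - c1 * z)%C end.
  - eapply is_series_ext; [|exact (Hf z Hz)].
    intros n. cbv beta. rewrite Cpow_inv by exact Hz0. reflexivity.
  - unfold plus, opp; simpl.
    change ((f z - c1 * z)%C = (f z - c1 * z + - (0 * 1))%C). ring.
Qed.

Lemma Cmod_inv_le_1 (z : C) : Omega_bar z -> Cmod (/ z)%C <= 1.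
Proof.
  intros Hz. unfold Omega_bar in Hz.
  rewrite Cmod_inv by (apply Cmod_gt_0; lra).
  rewrite <- Rinv_1. apply Rinv_le_contravar; lra.
Qed.

Lemma Omega_bar_neq_0 (z : C) : Omega_bar z -> z <> 0%C.
Proof. intros Hz. apply Cmod_gt_0. unfold Omega_bar in Hz. lra. Qed.

Lemma laurent_continuous (f : C -> C) :
  laurent_expansion f -> forall z, Omega_bar z -> cont_at Omega_bar f z.
Proof.
  intros H z Hz. destruct (laurent_expansion_CPS f H) as [c1 [u [_ [Hu Hf]]]].
  assert (Hc : cont_at Omega_bar (fun z => c1 * z + CPS u (/ z))%C z).
  { apply cont_at_plus.
    - apply cont_at_mult; [apply cont_at_const|apply cont_at_id].
    - apply (cont_at_comp _ (fun w => Cmod w <= 1)).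
      + apply Cmod_inv_le_1.
      + apply cont_at_inv, Omega_bar_neq_0, Hz.
      + apply cont_at_CPS; [exact Hu|]. apply Cmod_inv_le_1, Hz. }
  intros e He. destruct (Hc e He) as [d [Hd Hd']]. exists d.
  split; [exact Hd|]. intros w Hw. rewrite (Hf w Hw), (Hf z Hz). auto.
Qed.

(** The linear term dominates: |f(z)| is at least |c1| |z| minus the l1-norm of the other
    coefficients. *)
Lemma laurent_proper (f : C -> C) (M : R) :
  laurent_expansion f -> exists r, forall z, r < Cmod z -> M < Cmod (f z).
Proof.
  intros H. destruct (laurent_expansion_CPS f H) as [c1 [u [Hc1 [Hu Hf]]]].
  assert (Hp := proj1 (Cmod_gt_0 c1) Hc1).
  exists (Rmax 1 ((M + l1norm u) / Cmod c1)). intros z Hz.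
  assert (H1 := Rle_lt_trans _ _ _ (Rmax_l _ _) Hz).
  assert (H2 := Rle_lt_trans _ _ _ (Rmax_r _ _) Hz).
  assert (Hz1 : Omega_bar z) by (unfold Omega_bar; lra).
  rewrite (Hf z Hz1).
  generalize (CPS_Cmod_le u (/ z) Hu (Cmod_inv_le_1 z Hz1)).
  generalize (Cmod_triangle_rev (c1 * z) (- CPS u (/ z))).
  rewrite Cmod_opp, Cmod_mult.
  replace (c1 * z - - CPS u (/ z))%C with (c1 * z + CPS u (/ z))%C by ring.
  apply (Rmult_lt_compat_r (Cmod c1)) in H2; [|exact Hp].
  unfold Rdiv in H2. rewrite Rmult_assoc, Rinv_l, Rmult_1_r in H2 by lra. lra.
Qed.

(** Properness leaves only a compact annulus to consider, on which the distance from [f z] to [x]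
    attains a positive minimum. *)
Lemma laurent_image_closed (f : C -> C) (x : C) :
  laurent_expansion f -> (forall z, Omega_bar z -> f z <> x) ->
  exists d, 0 < d /\ forall z, Omega_bar z -> d <= Cmod (f z - x)%C.
Proof.
  intros H Hx. destruct (laurent_proper f (Cmod x + 1) H) as [r Hr].
  set (K := fun z : C => 1 <= Cmod (z - 0)%C <= Rmax 1 r).
  assert (HKO : forall z, K z -> Omega_bar z).
  { intros z [Hz _]. unfold Omega_bar. replace z with (z - 0)%C by ring. exact Hz. }
  destruct (uniformizing_min K (fun z => Cmod (f z - x)%C)) as [z0 [K0 H0]].
  - apply annulus_uniformizing.
  - exists 1%C. unfold K. replace (1 - 0)%C with (RtoC 1) by ring.
    rewrite Cmod_1. split; [lra|apply Rmax_l].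
  - apply eps_cont_on_dist. intros z Kz.
    apply (cont_at_sub _ Omega_bar); [exact HKO|].
    apply laurent_continuous; auto.
  - exists (Rmin 1 (Cmod (f z0 - x)%C)). split.
    + apply Rmin_pos; [lra|]. apply Cmod_gt_0. intros E.
      apply (Hx z0 (HKO z0 K0)). replace (f z0) with (f z0 - x + x)%C by ring.
      rewrite E. ring.
    + intros z Hz. destruct (Rle_lt_dec (Cmod z) (Rmax 1 r)) as [Hl|Hl].
      * eapply Rle_trans; [apply Rmin_r|]. apply H0. unfold K.
        replace (z - 0)%C with z by ring. split; assumption.
      * eapply Rle_trans; [apply Rmin_l|].
        generalize (Hr z (Rle_lt_trans _ _ _ (Rmax_r _ _) Hl))
          (Cmod_triangle_rev (f z) x). lra.
Qed.

Lemma inv_Omega (eta : C) : 0 < Cmod eta < 1 -> Omega (/ eta)%C.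
Proof.
  intros H. unfold Omega. rewrite Cmod_inv by (apply Cmod_gt_0; lra).
  rewrite <- Rinv_1 at 1. apply Rinv_lt_contravar; lra.
Qed.

Lemma Cinv_neq_0 (z : C) : z <> 0%C -> (/ z)%C <> 0%C.
Proof.
  intros H. apply Cmod_gt_0. rewrite Cmod_inv by exact H.
  apply Rinv_0_lt_compat, Cmod_gt_0, H.
Qed.

Lemma Cinv_involutive (z : C) : z <> 0%C -> (/ / z)%C = z.
Proof.
  intros H. transitivity (/ / z * (/ z * z))%C.
  - rewrite Cinv_l by exact H. ring.
  - rewrite Cmult_assoc, Cinv_l by (apply Cinv_neq_0, H). ring.
Qed.

(** The minimum modulus principle for f(1/x) - w in the coordinate x = 1/z, which sends [Omega] to
    the punctured unit disk. *)
Lemma univalent_no_local_min (f : C -> C) (eta w : C) (r : R) :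
  laurent_expansion f ->
  (forall z1 z2, Omega z1 -> Omega z2 -> f z1 = f z2 -> z1 = z2) ->
  0 < Cmod eta < 1 -> f (/ eta)%C <> w -> 0 < r ->
  exists eta', Cmod (eta' - eta)%C < r /\ 0 < Cmod eta' < 1 /\
    Cmod (f (/ eta') - w)%C < Cmod (f (/ eta) - w)%C.
Proof.
  intros H Hinj Heta Hw Hr.
  destruct (laurent_expansion_CPS f H) as [c1 [u [Hc1 [Hu Hf]]]].
  assert (Hform : forall x, 0 < Cmod x < 1 ->
    f (/ x)%C = (c1 / x + CPS u x)%C).
  { intros x Hx. assert (Hx0 : x <> 0%C) by (apply Cmod_gt_0; lra).
    rewrite Hf.
    - rewrite (Cinv_involutive x Hx0). reflexivity.
    - apply Rlt_le, inv_Omega, Hx. }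
  assert (Heta0 : eta <> 0%C) by (apply Cmod_gt_0; lra).
  destruct (quot_coef_summable u eta Hu (proj2 Heta)) as [Hq _].
  (* Since c1/x - c1/eta = (x - eta) (-c1/eta) / x, the difference of the values of f(1/x) is (x -
     eta)/x times a power series with constant term -c1/eta followed by the quotient
     coefficients. *)
  set (b := fun n => match n with
    O => (- c1 / eta)%C | S m => quot_coef u eta m end).
  assert (Hb : summable b) by (apply summable_of_tail; exact Hq).
  assert (Hdiff : forall x, 0 < Cmod x < 1 ->
    (f (/ x) - f (/ eta) = (x - eta) * (CPS b x * / x))%C).
  { intros x Hx. assert (Hx0 : x <> 0%C) by (apply Cmod_gt_0; lra).
    rewrite (Hform x Hx), (Hform eta Heta).
    rewrite (CPS_quot u eta x Hu (proj2 Heta)) by lra.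
    rewrite (CPS_unfold b x Hb) by lra.
    change (cshift 1 b) with (quot_coef u eta).
    change (b 0%nat) with (- c1 / eta)%C.
    field. split; assumption. }
  assert (Hnear : exists rho, 0 < rho <= r /\
    forall x, Cmod (x - eta)%C < rho -> 0 < Cmod x < 1).
  { exists (Rmin r (Rmin (Cmod eta) (1 - Cmod eta))). split.
    - split; [repeat apply Rmin_pos; lra|apply Rmin_l].
    - intros x Hx.
      assert (Hx' := Rlt_le_trans _ _ _ Hx (Rmin_r _ _)).
      generalize (Rlt_le_trans _ _ _ Hx' (Rmin_l _ _))
        (Rlt_le_trans _ _ _ Hx' (Rmin_r _ _))
        (Cmod_triangle_rev x eta) (Cmod_triangle_rev eta x).
      rewrite (Cmod_minus_sym eta x). lra. }
  destruct Hnear as [rho [Hrho Hnear]].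
  destruct (CPS_order b eta Hb (proj2 Heta)) as [[e [He Hz]]|[k [b' [Hb' [Hne Hz]]]]].
  (* If [b] vanished near [eta], [f] would take the same value at two distinct points of [Omega]. *)
  - exfalso. set (t := Rmin e rho / 2).
    assert (Ht : 0 < t < Rmin e rho).
    { assert (0 < Rmin e rho) by (apply Rmin_pos; lra). unfold t. lra. }
    assert (Hd : Cmod (eta + t - eta)%C = t).
    { replace (eta + t - eta)%C with (RtoC t) by ring.
      rewrite Cmod_R, Rabs_pos_eq; lra. }
    generalize (Rmin_l e rho) (Rmin_r e rho). intros M1 M2.
    assert (Hx : 0 < Cmod (eta + t)%C < 1) by (apply Hnear; rewrite Hd; lra).
    assert (E := Hdiff _ Hx). rewrite Hz in E; [|lra|rewrite Hd; lra].
    assert (E' : f (/ (eta + t))%C = f (/ eta)%C).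
    { replace (f (/ (eta + t))%C) with
        (f (/ (eta + t)) - f (/ eta) + f (/ eta))%C by ring. rewrite E. ring. }
    apply Hinj in E'; try (apply inv_Omega; assumption).
    apply (f_equal Cinv) in E'.
    rewrite !Cinv_involutive in E' by (apply Cmod_gt_0; lra).
    rewrite E', Cminus_diag, Cmod_0 in Hd. lra.
  (* The exponent is [S k]: one factor [x - eta] comes from the difference of values and [k] from
     the order of [b]. *)
  - destruct (modulus_descent (fun x => CPS b' x * / x)%C eta
      (f (/ eta) - w)%C (S k) rho) as [x [Hx Hlt]].
    + lra.
    + lia.
    + intros E. apply Hw. replace (f (/ eta)%C) with (f (/ eta) - w + w)%C by ring.
      rewrite E. ring.
    + apply Cmult_neq_0; [exact Hne|].
      apply Cinv_neq_0, Heta0.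
    + assert (Hc : cont_at (fun x => Cmod x <= 1) (fun x => CPS b' x * / x)%C eta).
      { apply cont_at_mult; [apply cont_at_CPS; [exact Hb'|lra]|].
        apply cont_at_inv, Heta0. }
      intros e He. destruct (Hc e He) as [d [Hd Hd']].
      exists (Rmin d rho). split; [apply Rmin_pos; lra|]. intros z Hzd.
      apply Hd'; [|exact (Rlt_le_trans _ _ _ Hzd (Rmin_l _ _))].
      apply Rlt_le, Hnear. exact (Rlt_le_trans _ _ _ Hzd (Rmin_r _ _)).
    + exists x. assert (Hx1 := Hnear x Hx). split; [lra|]. split; [exact Hx1|].
      eapply Rle_lt_trans; [|exact Hlt]. apply Req_le. f_equal.
      transitivity ((f (/ eta) - w) + (f (/ x) - f (/ eta)))%C; [ring|].
      rewrite (Hdiff x Hx1), (Hz x) by lra. rewrite Cpow_S. ring.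
Qed.

(** * Shapes whose boundary lies on a line *)


Lemma Cmod_scal (t : R) (z : C) : 0 <= t -> Cmod (t * z)%C = t * Cmod z.
Proof. intros H. rewrite Cmod_mult, Cmod_R, Rabs_pos_eq; auto. Qed.

Lemma exterior_approx (z : C) (e : R) :
  Cmod z = 1 -> 0 < e ->
  exists w, Cmod (w - z)%C < e /\ 1 < Cmod w < 1 + e.
Proof.
  intros Hz He. exists ((1 + e / 2)%R * z)%C.
  replace ((1 + e / 2)%R * z - z)%C with ((e / 2)%R * z)%C
    by (rewrite RtoC_plus; ring).
  rewrite !Cmod_scal by lra. rewrite Hz. lra.
Qed.

(** By the open mapping property, every value close to [f z] is attained near [z]. If
    [f zeta = f z], points of [Omega] close to [zeta] take such values as well, against
    injectivity. *)
Lemma univalent_boundary_disjoint (f : C -> C) (zeta z : C) :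
  laurent_expansion f ->
  (forall z1 z2, Omega z1 -> Omega z2 -> f z1 = f z2 -> z1 = z2) ->
  Cmod zeta = 1 -> Omega z -> f zeta <> f z.
Proof.
  intros H Hinj Hzeta Hz Heq.
  set (g := fun eta => f (/ eta)%C).
  assert (Hz0 : z <> 0%C) by (apply Omega_bar_neq_0, Rlt_le, Hz).
  set (eta0 := (/ z)%C).
  assert (Heta0 : 0 < Cmod eta0 < 1).
  { unfold eta0. rewrite Cmod_inv by exact Hz0. unfold Omega in Hz. split.
    - apply Rinv_0_lt_compat. lra.
    - rewrite <- Rinv_1 at 1. apply Rinv_lt_contravar; lra. }
  assert (Hg0 : g eta0 = f z).
  { unfold g, eta0. f_equal. apply Cinv_involutive, Hz0. }
  assert (Hginj : forall x y, 0 < Cmod x < 1 -> 0 < Cmod y < 1 ->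
    g x = g y -> x = y).
  { intros x y Hx Hy E. apply Hinj in E; try (apply inv_Omega; assumption).
    apply (f_equal Cinv) in E.
    rewrite !Cinv_involutive in E by (apply Cmod_gt_0; lra). exact E. }
  set (rho := Rmin (Cmod eta0) (1 - Cmod eta0) / 2).
  assert (Hrho : 0 < rho /\ rho < Cmod eta0 /\ rho < 1 - Cmod eta0).
  { generalize (Rmin_l (Cmod eta0) (1 - Cmod eta0))
      (Rmin_r (Cmod eta0) (1 - Cmod eta0)).
    assert (0 < Rmin (Cmod eta0) (1 - Cmod eta0)) by (apply Rmin_pos; lra).
    unfold rho. lra. }
  assert (Hdisk : forall x, Cmod (x - eta0)%C <= rho ->
    0 < Cmod x <= Cmod eta0 + rho).
  { intros x Hx. generalize (Cmod_triangle_rev x eta0) (Cmod_triangle_rev eta0 x).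
    rewrite (Cmod_minus_sym eta0 x). lra. }
  assert (Hgc : forall (K : C -> Prop) x, (forall y, K y -> Cmod (y - eta0)%C <= rho) ->
    K x -> cont_at K g x).
  { intros K x HK Kx. unfold g.
    assert (HK' : forall y, K y -> 0 < Cmod y < 1)
      by (intros y Ky; generalize (Hdisk y (HK y Ky)); lra).
    apply (cont_at_comp _ Omega_bar).
    - intros y Ky. apply Rlt_le, inv_Omega, HK', Ky.
    - apply cont_at_inv. apply Cmod_gt_0. apply HK', Kx.
    - apply laurent_continuous; [exact H|].
      apply Rlt_le, inv_Omega, HK', Kx. }
  (* On the circle of radius [rho] around [eta0], injectivity keeps [g] at a positive distance [m]
     from [f z]. *)
  destruct (uniformizing_min (fun x => rho <= Cmod (x - eta0)%C <= rho)
    (fun x => Cmod (g x - f z)%C)) as [xs [Hxs Hmin]].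
  { apply annulus_uniformizing. }
  { exists (eta0 + rho)%C. replace (eta0 + rho - eta0)%C with (RtoC rho) by ring.
    rewrite Cmod_R, Rabs_pos_eq; lra. }
  { apply eps_cont_on_dist. intros x Hx. apply Hgc; [intros y Hy; lra|exact Hx]. }
  set (m := Cmod (g xs - f z)%C) in *.
  assert (Hm : 0 < m).
  { apply Cmod_gt_0. intros E.
    assert (E' : g xs = g eta0).
    { rewrite Hg0. replace (g xs) with (g xs - f z + f z)%C by ring.
      rewrite E. ring. }
    apply Hginj in E'; [|generalize (Hdisk xs (proj2 Hxs)); lra|exact Heta0].
    rewrite E', Cminus_diag, Cmod_0 in Hxs. lra. }
  assert (Hzb : Omega_bar zeta) by (unfold Omega_bar; lra).
  destruct (laurent_continuous f H zeta Hzb (m / 2)) as [d [Hd Hc]]; [lra|].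
  (* With s = |eta0| + rho < 1, the second bound gives |zt| < 2 - s, and s (2 - s) < 1 places 1/zt
     outside the disk around [eta0]. *)
  destruct (exterior_approx zeta (Rmin d (1 - (Cmod eta0 + rho))) Hzeta)
    as [zt [Hzt1 Hzt2]]; [apply Rmin_pos; lra|].
  assert (Hzt3 := Rlt_le_trans _ _ _ Hzt1 (Rmin_l _ _)).
  assert (Hzt4 : Cmod zt < 1 + (1 - (Cmod eta0 + rho))).
  { generalize (Rmin_r d (1 - (Cmod eta0 + rho))). lra. }
  assert (Hw : Cmod (f zt - f z)%C < m / 2).
  { rewrite <- Heq. apply Hc; [unfold Omega_bar; lra|exact Hzt3]. }
  set (w := f zt) in *.
  destruct (uniformizing_min (fun x => 0 <= Cmod (x - eta0)%C <= rho)
    (fun x => Cmod (g x - w)%C)) as [x1 [Hx1 Hmin1]].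
  { apply annulus_uniformizing. }
  { exists eta0. rewrite Cminus_diag, Cmod_0. lra. }
  { apply eps_cont_on_dist. intros x Hx. apply Hgc; [intros y Hy; lra|exact Hx]. }
  assert (Hc0 : Cmod (g x1 - w)%C <= Cmod (g eta0 - w)%C).
  { apply Hmin1. rewrite Cminus_diag, Cmod_0. lra. }
  rewrite Hg0, (Cmod_minus_sym (f z) w) in Hc0.
  assert (Hx1d := Hdisk x1 (proj2 Hx1)).
  (* The distance to [w] is below [m / 2] at the centre and above [m / 2] on the circle, so the
     minimum is interior. *)
  assert (Hint : Cmod (x1 - eta0)%C < rho).
  { destruct (Rlt_le_dec (Cmod (x1 - eta0)%C) rho) as [Hl|Hl]; [exact Hl|].
    assert (m <= Cmod (g x1 - f z)%C) by (apply Hmin; lra).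
    generalize (Cmod_minus_triangle (g x1) w (f z)). lra. }
  destruct (univalent_no_local_min f x1 w (rho - Cmod (x1 - eta0)%C) H Hinj)
    as [x2 [Hx2 [Hx2' Hlt]]].
  - lra.
  - intros E. apply Hinj in E; [|apply inv_Omega; lra|unfold Omega; lra].
    assert (Ex : Cmod x1 * Cmod zt = 1).
    { rewrite <- E, <- Cmod_mult, Cinv_r, Cmod_1; [reflexivity|].
      apply Cmod_gt_0. lra. }
    nra.
  - lra.
  - assert (Cmod (g x1 - w)%C <= Cmod (g x2 - w)%C); [|unfold g in *; lra].
    apply Hmin1. split; [apply Cmod_ge_0|].
    generalize (Cmod_minus_triangle x2 x1 eta0). lra.
Qed.

(** If [f] were equal to [x0] there, the power series of z (f(1/z) - x0), whose constant term is
    [c1], would vanish on the unit circle. *)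
Lemma laurent_not_constant_on_circle (f : C -> C) (x0 : C) :
  laurent_expansion f -> ~ forall z, Cmod z = 1 -> f z = x0.
Proof.
  intros H Hx0. destruct (laurent_expansion_CPS f H) as [c1 [u [Hc1 [Hu Hf]]]].
  apply Hc1.
  set (b := fun n => match n with
    O => c1 | S O => (u 0%nat - x0)%C | S (S m) => u (S m) end).
  assert (Hb' : summable (cshift 1 b)).
  { apply summable_of_tail. exact (summable_cshift 1 u Hu). }
  assert (Hb : summable b) by (apply summable_of_tail; exact Hb').
  apply (CPS_constant_term b Hb). intros z Hz.
  assert (Hz1 : Cmod z <= 1) by lra.
  assert (Hz0 : z <> 0%C) by (apply Cmod_gt_0; lra).
  rewrite (CPS_unfold b z Hb Hz1), (CPS_unfold _ z Hb' Hz1).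
  change (cshift 1 (cshift 1 b)) with (cshift 1 u).
  change (b 0%nat) with c1. change (cshift 1 b 0%nat) with (u 0%nat - x0)%C.
  assert (E : (c1 * / z + CPS u z)%C = x0).
  { rewrite <- (Hx0 (/ z)%C), Hf.
    - rewrite Cinv_involutive by exact Hz0. reflexivity.
    - unfold Omega_bar. rewrite Cmod_inv by exact Hz0. rewrite Hz. lra.
    - rewrite Cmod_inv by exact Hz0. rewrite Hz. lra. }
  rewrite (CPS_unfold u z Hu Hz1) in E. rewrite <- E. field. exact Hz0.
Qed.

(** * Paths meeting the boundary of a shape *)

Lemma shape_boundary_in (S0 : C -> Prop) (f : C -> C) (z : C) :
  is_shape S0 f -> Cmod z = 1 -> S0 (f z).
Proof.
  intros [_ [_ [HL [_ [Hinj HF]]]]] Hz. apply NNPP. intros Hn.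
  apply HF in Hn. destruct Hn as [y [Hy E]].
  exact (univalent_boundary_disjoint f z y HL Hinj Hz Hy (eq_sym E)).
Qed.

Lemma shape_not_point (S0 : C -> Prop) (f : C -> C) (x0 : C) :
  is_shape S0 f -> ~ forall x, S0 x -> x = x0.
Proof.
  intros H Hx. apply (laurent_not_constant_on_circle f x0); [apply H|].
  intros z Hz. apply Hx. exact (shape_boundary_in S0 f z H Hz).
Qed.

Lemma shape_uniformizing (S0 : C -> Prop) (f : C -> C) :
  is_shape S0 f -> uniformizing S0.
Proof. intros [H _]. exact (compact_set_uniformizing S0 H). Qed.

(** Otherwise membership in [S0] would be locally constant along the path: [S0] is closed, and a
    point of [S0] not on the image of the circle is at positive distance from the image of
    [Omega_bar]. *)
Lemma shape_crossing (S0 : C -> Prop) (f : C -> C) (g : R -> C) :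
  is_shape S0 f ->
  (forall t, 0 <= t <= 1 -> forall e, 0 < e -> exists d, 0 < d /\
     forall s, 0 <= s <= 1 -> Rabs (s - t) < d -> Cmod (g s - g t)%C < e) ->
  ~ S0 (g 0) -> S0 (g 1) ->
  exists t z, 0 <= t <= 1 /\ Cmod z = 1 /\ f z = g t.
Proof.
  intros H Hg H0 H1. apply NNPP. intros Hno.
  assert (HS := shape_uniformizing S0 f H).
  destruct H as [_ [_ [HL [_ [Hinj HF]]]]].
  apply (unit_interval_connected (fun t => ~ S0 (g t))); [|exact H0|exact H1].
  intros t Ht. destruct (classic (S0 (g t))) as [St|St].
  - destruct (laurent_image_closed f (g t) HL) as [e [He Hfar]].
    { intros z [Hz|Hz] E.
      - apply (proj2 (HF (g t))); [exists z; auto|exact St].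
      - apply Hno. exists t, z. auto. }
    destruct (Hg t Ht e He) as [d [Hd Hs]]. exists d. split; [exact Hd|].
    intros s Hs1 Hs2. split; [|tauto]. intros Hn. exfalso.
    apply HF in Hn. destruct Hn as [z [Hz E]].
    generalize (Hfar z (Rlt_le _ _ Hz)) (Hs s Hs1 Hs2). rewrite E. lra.
  - destruct (uniformizing_closed S0 HS (g t) St) as [e [He Hn]].
    destruct (Hg t Ht e He) as [d [Hd Hs]]. exists d. split; [exact Hd|].
    intros s Hs1 Hs2. split; [tauto|]. intros _. apply Hn, Hs; assumption.
Qed.

Lemma shape_segment_crossing (S0 : C -> Prop) (f : C -> C) (x y : C) :
  is_shape S0 f -> ~ S0 x -> S0 y ->
  exists (t : R) (z : C), 0 <= t <= 1 /\ Cmod z = 1 /\ f z = (x + t * (y - x))%C.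
Proof.
  intros H Hx Hy. apply (shape_crossing S0 f (fun t : R => (x + t * (y - x))%C) H).
  - intros t _ e He. assert (Hp := Cmod_ge_0 (y - x)%C).
    exists (e / (Cmod (y - x)%C + 1)). split; [apply Rdiv_lt_0_compat; lra|].
    intros s _ Hs.
    replace (x + s * (y - x) - (x + t * (y - x)))%C with ((s - t)%R * (y - x))%C
      by (rewrite RtoC_minus; ring).
    rewrite Cmod_mult, Cmod_R.
    apply (Rmult_lt_compat_r (Cmod (y - x)%C + 1)) in Hs; [|lra].
    unfold Rdiv in Hs. rewrite Rmult_assoc, Rinv_l, Rmult_1_r in Hs by lra.
    generalize (Rabs_pos (s - t)). nra.
  - replace (x + 0 * (y - x))%C with x by ring. exact Hx.
  - replace (x + 1 * (y - x))%C with y by ring. exact Hy.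
Qed.

Lemma shape_far_point (S0 : C -> Prop) (f : C -> C) (x d : C) :
  is_shape S0 f -> d <> 0%C -> exists T : R, 0 < T /\ ~ S0 (x + T * d)%C.
Proof.
  intros H Hd. assert (Hp := proj1 (Cmod_gt_0 d) Hd).
  destruct (uniformizing_bounded S0 (shape_uniformizing S0 f H)) as [M HM].
  assert (HM0 := Rabs_pos M). assert (Hx := Cmod_ge_0 x).
  exists ((Rabs M + 1 + Cmod x) / Cmod d).
  assert (HT : 0 < (Rabs M + 1 + Cmod x) / Cmod d)
    by (apply Rdiv_lt_0_compat; lra).
  split; [exact HT|]. intros Hn. apply HM in Hn.
  generalize (Cmod_triangle_rev (((Rabs M + 1 + Cmod x) / Cmod d)%R * d) (- x)).
  rewrite Cmod_opp, Cmod_scal by lra.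
  match goal with |- context[Cmod (?a - - x)%C] =>
    replace (a - - x)%C with (x + a)%C by ring end.
  replace ((Rabs M + 1 + Cmod x) / Cmod d * Cmod d) with (Rabs M + 1 + Cmod x)
    by (field; lra).
  generalize (Rle_abs M). lra.
Qed.

(** A path in [K] joining a minimum of [h] to a maximum takes every intermediate value, and [P]
    recovers the point from its value. Segments and arcs are both identified in this way. *)
Lemma connected_compact_interval_image (K : C -> Prop) (h : C -> R) (P : R -> C) :
  uniformizing K -> path_connected K -> eps_cont_on K h ->
  (forall z, K z -> z = P (h z)) ->
  exists m M, m <= M /\ forall z, K z <-> exists t, m <= t <= M /\ z = P t.
Proof.
  intros HK [Hne Hpath] Hh HP.
  destruct (uniformizing_min K h HK Hne Hh) as [a [Ka Ha]].
  destruct (uniformizing_min K (fun z => - h z) HK Hne) as [b [Kb Hb]].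
  { intros x Kx e He. destruct (Hh x Kx e He) as [d [Hd H]].
    exists d. split; [exact Hd|]. intros y Ky Hy.
    replace (- h y - - h x) with (- (h y - h x)) by ring.
    rewrite Rabs_Ropp. auto. }
  exists (h a), (h b). split; [apply Ha, Kb|].
  intros z. split.
  - intros Kz. exists (h z). split; [|apply HP, Kz].
    generalize (Ha z Kz) (Hb z Kz). lra.
  - intros [t [Ht ->]].
    destruct (Hpath a b Ka Kb) as [g [[Hgc Hg] [G0 G1]]].
    destruct (unit_interval_ivt (fun s => h (g s)) t) as [s [Hs E]].
    + intros s Hs e He. destruct (Hh (g s) (Hg s Hs) e He) as [d [Hd H]].
      destruct (path_continuous_eps g Hgc s Hs d Hd) as [d' [Hd' H']].
      exists d'. split; [exact Hd'|]. intros s' Hs' Hss.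
      apply H; [apply Hg, Hs'|]. auto.
    + rewrite G0, G1. exact Ht.
    + rewrite <- E, <- HP by (apply Hg, Hs). apply Hg, Hs.
Qed.

Lemma eps_cont_on_fst (K : C -> Prop) (g : C -> C) :
  (forall z, K z -> cont_at K g z) -> eps_cont_on K (fun z => fst (g z)).
Proof.
  intros H z Kz e He. destruct (H z Kz e He) as [d [Hd Hg]].
  exists d. split; [exact Hd|]. intros w Kw Hw.
  eapply Rle_lt_trans; [|exact (Hg w Kw Hw)].
  exact (Re_le_Cmod (g w - g z)%C).
Qed.

Lemma shape_in_line (S0 : C -> Prop) (f : C -> C) (p q k : R) :
  is_shape S0 f -> 0 < p ^ 2 + q ^ 2 ->
  (forall z, Cmod z = 1 -> p * fst (f z) + q * snd (f z) = k) ->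
  forall x, S0 x -> p * fst x + q * snd x = k.
Proof.
  intros H Hpq Hb x Sx. apply NNPP. intros Hne.
  set (l := p * fst x + q * snd x - k).
  assert (Hl : l <> 0) by (unfold l; lra).
  (* The factor [l] directs the normal away from the line on the side of [x], so the segment from
     the far point to [x] cannot meet the line. *)
  set (d := (l * p, l * q) : C).
  destruct (shape_far_point S0 f x d H) as [T [HT Hfar]].
  { intros E. assert (E1 := f_equal fst E). assert (E2 := f_equal snd E).
    unfold d in E1, E2; simpl in E1, E2.
    apply Hl. apply Rmult_integral in E1. apply Rmult_integral in E2. nra. }
  destruct (shape_segment_crossing S0 f _ x H Hfar Sx) as [t [z [Ht [Hz E]]]].
  specialize (Hb z Hz). rewrite E in Hb. unfold d in Hb; simpl in Hb.
  assert (E' : l * (1 + (1 - t) * T * (p ^ 2 + q ^ 2)) = 0) by (unfold l in *; lra).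
  apply Rmult_integral in E'. destruct E' as [E'|E']; [exact (Hl E')|].
  assert (0 <= (1 - t) * T) by nra. nra.
Qed.

Lemma shape_line_segment (S0 : C -> Prop) (f : C -> C) (p q k : R) :
  is_shape S0 f -> 0 < p ^ 2 + q ^ 2 ->
  (forall z, Cmod z = 1 -> p * fst (f z) + q * snd (f z) = k) ->
  is_segment S0.
Proof.
  intros H Hpq Hb. assert (HS := shape_in_line S0 f p q k H Hpq Hb).
  set (n := p ^ 2 + q ^ 2) in *.
  (* The point of the line with coordinate t = -q x + p y. This coordinate is written below as the
     real part of a complex product, which makes it visibly continuous. *)
  set (P := fun t : R => ((k * p - q * t) / n, (k * q + p * t) / n) : C).
  destruct (connected_compact_interval_image S0
    (fun z => fst (((- q)%R, (- p)%R) * z)%C) P) as [m [M [HmM HI]]].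
  - exact (shape_uniformizing S0 f H).
  - apply H.
  - apply eps_cont_on_fst. intros z _.
    apply cont_at_mult; [apply cont_at_const|apply cont_at_id].
  - intros z Sz. specialize (HS z Sz). destruct z as [x y]. simpl in *.
    unfold P. f_equal; rewrite <- HS; unfold n; field;
      unfold n in Hpq; intros E; lra.
  - assert (Hlt : m < M).
    { destruct HmM as [Hl|E]; [exact Hl|exfalso].
      apply (shape_not_point S0 f (P m) H). intros x Sx.
      apply HI in Sx. destruct Sx as [t [Ht ->]]. f_equal. lra. }
    assert (HP : forall t : R, P (m + t * (M - m)) = (P m + t * (P M - P m))%C).
    { intros t. unfold P, Cplus, Cmult, Cminus, Copp, RtoC, Cplus; simpl.
      f_equal; field; lra. }
    exists (P m), (P M). split.
    + intros E. assert (E1 := f_equal fst E). assert (E2 := f_equal snd E).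
      unfold P in E1, E2; simpl in E1, E2.
      apply (f_equal (Rmult n)) in E1. apply (f_equal (Rmult n)) in E2.
      unfold Rdiv in E1, E2.
      rewrite <- !Rmult_assoc, !(Rmult_comm n), !Rmult_assoc, !Rinv_r,
        !Rmult_1_r in E1, E2 by lra.
      assert (q * (M - m) = 0) by lra. assert (p * (M - m) = 0) by lra.
      apply Rmult_integral in H0. apply Rmult_integral in H1.
      unfold n in Hpq. nra.
    + intros z. rewrite HI. split.
      * intros [t [Ht ->]]. exists ((t - m) / (M - m)). split.
        { split.
          - apply Rmult_le_reg_r with (M - m); [lra|].
            unfold Rdiv. rewrite Rmult_assoc, Rinv_l; lra.
          - apply Rmult_le_reg_r with (M - m); [lra|].
            unfold Rdiv. rewrite Rmult_assoc, Rinv_l; lra. }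
        rewrite <- HP. f_equal. field. lra.
      * intros [t [Ht ->]]. exists (m + t * (M - m)).
        split; [nra|]. symmetry. apply HP.
Qed.

(** * Shapes whose boundary lies on a circle *)


Lemma atan_half_angle (x y : R) :
  x ^ 2 + y ^ 2 = 1 -> 1 + x <> 0 -> cis (2 * atan (y / (1 + x))) = (x, y).
Proof.
  intros H Hx. set (t := y / (1 + x)).
  assert (Ht : t * (1 + x) = y) by (unfold t; field; exact Hx).
  assert (Hp : 0 < 1 + t²) by (generalize (Rle_0_sqr t); lra).
  assert (Hs := sqrt_lt_R0 _ Hp).
  assert (Hss := sqrt_sqrt _ (Rlt_le _ _ Hp)).
  (* This is the half-angle formula for the squared cosine of [atan t]. *)
  assert (Hc : 1 / sqrt (1 + t²) * (1 / sqrt (1 + t²)) = (1 + x) / 2).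
  { replace (1 / sqrt (1 + t²) * (1 / sqrt (1 + t²)))
      with (/ (sqrt (1 + t²) * sqrt (1 + t²))) by (field; lra).
    rewrite Hss. apply (Rmult_eq_reg_l (1 + t²)); [|lra]. rewrite Rinv_r by lra.
    unfold Rsqr. apply (Rmult_eq_reg_l (1 + x)); [|exact Hx]. nra. }
  unfold cis. rewrite cos_2a, sin_2a, cos_atan, sin_atan. f_equal.
  - transitivity ((1 - t * t) * (1 / sqrt (1 + t²) * (1 / sqrt (1 + t²)))).
    + field. lra.
    + rewrite Hc. apply (Rmult_eq_reg_l (1 + x)); [|exact Hx]. nra.
  - transitivity (2 * t * (1 / sqrt (1 + t²) * (1 / sqrt (1 + t²)))).
    + field. lra.
    + rewrite Hc. lra.
Qed.

(** From a point outside the disk, moving radially outward only increases the distance to [a], so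
    the exterior is reached without meeting the circle. *)
Lemma shape_in_closed_disk (S0 : C -> Prop) (f : C -> C) (a : C) (r : R) :
  is_shape S0 f -> (forall z, Cmod z = 1 -> Cmod (f z - a)%C = r) ->
  forall x, S0 x -> Cmod (x - a)%C <= r.
Proof.
  intros H Hb x Sx. apply Rnot_lt_le. intros Hlt.
  assert (Hr : 0 <= r).
  { rewrite <- (Hb 1%C Cmod_1). apply Cmod_ge_0. }
  destruct (shape_far_point S0 f x (x - a)%C H) as [T [HT Hfar]].
  { apply Cmod_gt_0. lra. }
  destruct (shape_segment_crossing S0 f _ x H Hfar Sx) as [t [z [Ht [Hz E]]]].
  specialize (Hb z Hz). rewrite E in Hb.
  assert (Htt : 0 <= (1 - t) * T) by nra.
  replace (x + T * (x - a) + t * (x - (x + T * (x - a))) - a)%C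
    with ((1 + (1 - t) * T)%R * (x - a))%C in Hb
    by (rewrite RtoC_plus, RtoC_mult, RtoC_minus; ring).
  rewrite Cmod_scal in Hb by lra. nra.
Qed.

(** The open disk is convex, so a segment between two of its points stays off the circle and cannot
    leave [S0]. *)
Lemma shape_open_disk_constant
  (S0 : C -> Prop) (f : C -> C) (a : C) (r : R) (x y : C) :
  is_shape S0 f -> (forall z, Cmod z = 1 -> Cmod (f z - a)%C = r) ->
  Cmod (x - a)%C < r -> Cmod (y - a)%C < r -> S0 y -> S0 x.
Proof.
  intros H Hb Hx Hy Sy. apply NNPP. intros Sx.
  destruct (shape_segment_crossing S0 f x y H Sx Sy) as [t [z [Ht [Hz E]]]].
  specialize (Hb z Hz). rewrite E in Hb.
  replace (x + t * (y - x) - a)%C with ((1 - t)%R * (x - a) + t * (y - a))%C in Hb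
    by (rewrite RtoC_minus; ring).
  generalize (Cmod_triangle ((1 - t)%R * (x - a)) (t * (y - a))).
  rewrite !Cmod_scal by lra. rewrite Hb.
  destruct (Rle_lt_dec (Cmod (x - a)%C) (Cmod (y - a)%C)); nra.
Qed.

Lemma shape_disk (S0 : C -> Prop) (f : C -> C) (a : C) (r : R) :
  is_shape S0 f -> (forall z, Cmod z = 1 -> Cmod (f z - a)%C = r) ->
  0 < r -> S0 a -> is_disk S0.
Proof.
  intros H Hb Hr Sa. exists a, r. split; [exact Hr|]. intros x. split.
  { apply (shape_in_closed_disk S0 f); assumption. }
  intros Hx.
  assert (Hin : forall y, Cmod (y - a)%C < r -> S0 y).
  { intros y Hy. apply (shape_open_disk_constant S0 f a r y a H Hb Hy);
      [|exact Sa]. rewrite Cminus_diag, Cmod_0. exact Hr. }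
  apply NNPP. intros Sx.
  destruct (uniformizing_closed S0 (shape_uniformizing S0 f H) x Sx)
    as [e [He Hn]].
  (* Pushing [x] towards [a] by the ratio [s] enters the open disk while moving by at most
     [e / 2]. *)
  set (s := Rmin 1 (e / (2 * r))).
  assert (Hs : 0 < s) by (apply Rmin_pos; [lra|apply Rdiv_lt_0_compat; lra]).
  assert (Hs1 : s <= 1) by apply Rmin_l.
  assert (Hs2 : s * r <= e / 2).
  { replace (e / 2) with (e / (2 * r) * r) by (field; lra).
    apply Rmult_le_compat_r; [lra|apply Rmin_r]. }
  apply (Hn (x - s * (x - a))%C).
  - replace (x - s * (x - a) - x)%C with (- (s * (x - a)))%C by ring.
    rewrite Cmod_opp, Cmod_scal by lra. nra.
  - apply Hin. replace (x - s * (x - a) - a)%C with ((1 - s)%R * (x - a))%C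
      by (rewrite RtoC_minus; ring).
    rewrite Cmod_scal by lra. generalize (Cmod_ge_0 (x - a)%C). nra.
Qed.

(** Here [a] is some [f z]. Along the ray from [z] to infinity the distance of the image to [a]
    grows from 0 past [r], so it equals [r] at a point of the exterior. *)
Lemma shape_misses_circle_point (S0 : C -> Prop) (f : C -> C) (a : C) (r : R) :
  is_shape S0 f -> 0 < r -> ~ S0 a ->
  exists x, Cmod (x - a)%C = r /\ ~ S0 x.
Proof.
  intros H Hr Sa. apply NNPP. intros Hno.
  destruct H as [_ [_ [HL [_ [_ HF]]]]].
  destruct (proj1 (HF a) Sa) as [z [Hz E]].
  destruct (laurent_proper f (r + Cmod a) HL) as [M HM].
  set (T := Rabs M). assert (HT : 0 <= T) by apply Rabs_pos.
  assert (Hz1 : 1 < Cmod z) by exact Hz.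
  assert (Hray : forall t, 0 <= t -> Omega ((1 + t * T)%R * z)%C).
  { intros t Ht. unfold Omega. assert (0 <= t * T) by nra.
    rewrite Cmod_scal by lra. nra. }
  destruct (unit_interval_ivt
    (fun t => Cmod (f ((1 + t * T)%R * z) - a)%C) r) as [t [Ht Et]].
  - intros t Ht e He.
    destruct (laurent_continuous f HL _ (Rlt_le _ _ (Hray t (proj1 Ht))) e He)
      as [d [Hd Hc]].
    assert (Hp : 0 < T * Cmod z + 1) by nra.
    exists (d / (T * Cmod z + 1)). split; [apply Rdiv_lt_0_compat; lra|].
    intros s Hs Hst.
    assert (Hcs : Cmod (f ((1 + s * T)%R * z) - f ((1 + t * T)%R * z))%C < e).
    { apply Hc; [apply Rlt_le, Hray; lra|].
      replace ((1 + s * T)%R * z - (1 + t * T)%R * z)%C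
        with ((s - t)%R * (T * z))%C
        by (rewrite !RtoC_plus, !RtoC_mult, RtoC_minus; ring).
      rewrite Cmod_mult, Cmod_R, Cmod_scal by exact HT.
      apply (Rmult_lt_compat_r (T * Cmod z + 1)) in Hst; [|exact Hp].
      unfold Rdiv in Hst. rewrite Rmult_assoc, Rinv_l, Rmult_1_r in Hst by lra.
      generalize (Rabs_pos (s - t)). nra. }
    set (ws := f ((1 + s * T)%R * z)%C) in *.
    set (wt := f ((1 + t * T)%R * z)%C) in *.
    generalize (Cmod_minus_triangle ws wt a) (Cmod_minus_triangle wt ws a).
    rewrite (Cmod_minus_sym wt ws).
    intros. apply Rabs_lt_between. lra.
  - split.
    + replace ((1 + 0 * T)%R * z)%C with z
        by (rewrite Rmult_0_l, Rplus_0_r; ring).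
      rewrite E, Cminus_diag, Cmod_0. lra.
    + generalize (HM ((1 + 1 * T)%R * z)%C).
      generalize (Cmod_triangle_rev (f ((1 + 1 * T)%R * z)%C) a).
      rewrite Cmod_scal by lra. generalize (Rle_abs M). fold T.
      intros H1 H2 H3. assert (M < (1 + 1 * T) * Cmod z) by nra.
      specialize (H3 H). lra.
  - apply Hno. exists (f ((1 + t * T)%R * z)%C). split; [exact Et|].
    apply HF. exists ((1 + t * T)%R * z)%C. split; [apply Hray; lra|reflexivity].
Qed.

(* With a - x0 = r e^{i t0}, the points of the circle other than x0 are
   parametrized by the tangent of half of their angle measured from t0. *)
Lemma shape_arc (S0 : C -> Prop) (f : C -> C) (a : C) (r : R) :
  is_shape S0 f -> (forall z, Cmod z = 1 -> Cmod (f z - a)%C = r) ->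
  0 < r -> ~ S0 a -> is_circle_arc S0.
Proof.
  intros H Hb Hr Sa.
  (* A point of [S0] in the open disk would force the centre [a] into [S0]. *)
  assert (Hcirc : forall x, S0 x -> Cmod (x - a)%C = r).
  { intros x Sx. destruct (shape_in_closed_disk S0 f a r H Hb x Sx) as [Hl|E];
      [exfalso|exact E].
    apply Sa. apply (shape_open_disk_constant S0 f a r a x H Hb); try assumption.
    rewrite Cminus_diag, Cmod_0. exact Hr. }
  destruct (shape_misses_circle_point S0 f a r H Hr Sa) as [x0 [Hx0 Sx0]].
  assert (Hrc : RtoC r <> 0%C) by (intros E; apply RtoC_inj in E; lra).
  destruct (unit_cis ((a - x0) / r)%C) as [t0 Ht0].
  { rewrite Cmod_div by exact Hrc. rewrite Cmod_R, Rabs_pos_eq by lra.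
    rewrite Cmod_minus_sym, Hx0. field. lra. }
  assert (Hc0 : cis t0 <> 0%C) by (apply Cmod_gt_0; rewrite Cmod_cis; lra).
  (* Normalized coordinate: the circle becomes the unit circle and the missing point [x0] becomes
     -1. *)
  set (u := fun z => ((z - a) * (/ (r * cis t0)))%C).
  assert (Hu : forall z, z = (a + r * (cis t0 * u z))%C)
    by (intros z; unfold u; field; auto).
  assert (Hu1 : forall z, S0 z -> Cmod (u z) = 1).
  { intros z Sz. unfold u.
    rewrite Cmod_mult, Cmod_inv by (apply Cmult_neq_0; assumption).
    rewrite Cmod_mult, Cmod_cis, Cmod_R, Rabs_pos_eq, (Hcirc z Sz) by lra.
    field. lra. }
  assert (Hu2 : forall z, S0 z -> (u z + 1)%C <> 0%C).
  { intros z Sz E. apply Sx0. replace x0 with z; [exact Sz|].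
    rewrite (Hu z). replace (u z) with (u z + 1 - 1)%C by ring. rewrite E.
    rewrite <- Ht0. field. exact Hrc. }
  (* A Cayley transform: at u = x + i y on the unit circle it equals y / (1 + x), the tangent of the
     half-angle. *)
  set (G := fun z => (- Ci * ((u z - 1) * / (u z + 1)))%C).
  set (h := fun z => fst (G z)).
  set (P := fun t : R => (a + r * cis (t0 + 2 * atan t))%C).
  assert (HP : forall z, S0 z -> z = P (h z)).
  { intros z Sz. rewrite (Hu z) at 1. unfold P. rewrite cis_plus.
    assert (E : cis (2 * atan (h z)) = u z); [|rewrite E; reflexivity].
    assert (N := Cmod_sqr (u z)). rewrite (Hu1 z Sz) in N.
    assert (Hne := Hu2 z Sz). unfold h, G.
    destruct (u z) as [x y]. simpl in N.
    assert (Hx : 1 + x <> 0).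
    { intros E. apply Hne. assert (y = 0) by nra. subst y.
      unfold Cplus, RtoC; simpl. f_equal; lra. }
    transitivity (cis (2 * atan (y / (1 + x))));
      [|apply atan_half_angle; [lra|exact Hx]].
    f_equal. f_equal. f_equal.
    unfold Ci, Cmult, Cinv, Cplus, Cminus, Copp, RtoC, Cplus; simpl.
    assert (Hd : (x + 1) * ((x + 1) * 1) + (y + 0) * ((y + 0) * 1) = 2 * (1 + x))
      by lra.
    rewrite Hd. field. exact Hx. }
  destruct (connected_compact_interval_image S0 h P) as [m [M [HmM HI]]].
  - exact (shape_uniformizing S0 f H).
  - apply H.
  - apply eps_cont_on_fst. intros z Sz.
    assert (Hcu : cont_at S0 u z).
    { apply cont_at_mult; [|apply cont_at_const].
      apply cont_at_plus; [apply cont_at_id|apply cont_at_const]. }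
    apply cont_at_mult; [apply cont_at_const|]. apply cont_at_mult.
    + apply cont_at_plus; [exact Hcu|apply cont_at_const].
    + apply (cont_at_comp S0 (fun _ => True) Cinv (fun z => u z + 1)%C z).
      * auto.
      * apply cont_at_plus; [exact Hcu|apply cont_at_const].
      * apply cont_at_inv, Hu2, Sz.
  - exact HP.
  - assert (Hlt : m < M).
    { destruct HmM as [Hl|E]; [exact Hl|exfalso].
      apply (shape_not_point S0 f (P m) H). intros x Sx.
      apply HI in Sx. destruct Sx as [t [Ht ->]]. f_equal. lra. }
    generalize (atan_increasing m M Hlt) (atan_bound m) (atan_bound M).
    intros A1 A2 A3.
    exists a, r, (t0 + 2 * atan m), (t0 + 2 * atan M).
    split; [exact Hr|]. split; [lra|].
    intros z. rewrite HI. split.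
    + intros [t [Ht ->]]. exists (t0 + 2 * atan t). split; [|reflexivity].
      assert (Hmono : forall x y, x <= y -> atan x <= atan y).
      { intros x y [Hxy| ->]; [apply Rlt_le, atan_increasing, Hxy|lra]. }
      generalize (Hmono _ _ (proj1 Ht)) (Hmono _ _ (proj2 Ht)). lra.
    + intros [t [Ht ->]]. exists (tan ((t - t0) / 2)).
      assert (Ha : atan (tan ((t - t0) / 2)) = (t - t0) / 2)
        by (apply atan_tan; lra).
      split.
      * split; apply Rnot_lt_le; intros Hn; apply atan_increasing in Hn;
          rewrite Ha in Hn; lra.
      * unfold P. rewrite Ha. do 3 f_equal. field.
Qed.

(** * From equal potentials to equal velocities *)

(** Exhibits the preimage of [e] under the rigid motion, so that a circle around [e] pulls back to a
    circle of the same radius. *)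
Lemma act_affine (p : position) (e z : C) :
  (act p z - e)%C = (cis (pos_angle p) *
    (z - (pos_center p - (pos_target p - e) * / cis (pos_angle p))))%C.
Proof.
  unfold act. field. apply Cmod_gt_0. rewrite Cmod_cis. lra.
Qed.

(** Every point of the unit circle is a limit of points of [Omega]. *)
Lemma same_extension_on_circle (g1 g2 : C -> C) :
  continuous_on (T := C_UniformSpace) (U := C_UniformSpace) Omega_bar g1 ->
  continuous_on (T := C_UniformSpace) (U := C_UniformSpace) Omega_bar g2 ->
  (forall z, Omega z -> g1 z = g2 z) ->
  forall z, Cmod z = 1 -> g1 z = g2 z.
Proof.
  intros H1 H2 H z Hz.
  assert (Hzb : Omega_bar z) by (unfold Omega_bar; lra).
  cut ((g1 z - g2 z)%C = 0%C).
  { intros E. replace (g1 z) with (g1 z - g2 z + g2 z)%C by ring. rewrite E. ring. }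
  apply Cmod_eq_0, Rle_antisym; [|apply Cmod_ge_0].
  apply Rle_plus_epsilon. intros e He.
  destruct (continuous_on_eps _ _ H1 z Hzb (e / 2)) as [d1 [Hd1 C1]]; [lra|].
  destruct (continuous_on_eps _ _ H2 z Hzb (e / 2)) as [d2 [Hd2 C2]]; [lra|].
  destruct (exterior_approx z (Rmin d1 d2) Hz) as [w [Hw1 Hw2]];
    [apply Rmin_pos; assumption|].
  assert (Hwb : Omega_bar w) by (unfold Omega_bar; lra).
  generalize (C1 w Hwb (Rlt_le_trans _ _ _ Hw1 (Rmin_l _ _)))
    (C2 w Hwb (Rlt_le_trans _ _ _ Hw1 (Rmin_r _ _)))
    (Cmod_minus_triangle (g1 z) (g1 w) (g2 z)).
  rewrite (Cmod_minus_sym (g1 z) (g1 w)), <- (H w) by (unfold Omega; lra). lra.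
Qed.

Lemma act_exterior (S0 : C -> Prop) (f : C -> C) (p : position) (z : C) :
  is_shape S0 f -> Omega z -> ~ placed p S0 (act p (f z)).
Proof.
  intros [_ [_ [_ [_ [_ HF]]]]] Hz [y [Sy E]].
  apply (proj2 (HF y)); [|exact Sy]. exists z. split; [exact Hz|].
  unfold act in E.
  assert (Hc : cis (pos_angle p) <> 0%C) by (apply Cmod_gt_0; rewrite Cmod_cis; lra).
  transitivity (/ cis (pos_angle p) * (cis (pos_angle p) * (f z - pos_center p)
    + pos_target p - pos_target p) + pos_center p)%C; [field; exact Hc|].
  rewrite E. field. exact Hc.
Qed.

Lemma shape_boundary_not_conic (S0 : C -> Prop) (f : C -> C) (p : position)
  (A B C0 D : R) :
  is_shape S0 f -> ~ is_disk S0 -> ~ is_circle_arc S0 -> ~ is_segment S0 ->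
  (forall z, Cmod z = 1 -> let x := act p (f z) in
     A * (fst x ^ 2 + snd x ^ 2) + B * fst x + C0 * snd x + D = 0) ->
  A = 0 /\ B = 0 /\ C0 = 0.
Proof.
  intros H Hdisk Harc Hseg Hz.
  destruct (Req_dec A 0) as [->|HA].
  - split; [reflexivity|].
    destruct (classic (B = 0 /\ C0 = 0)) as [HBC|HBC]; [exact HBC|exfalso].
    assert (Hpos : 0 < B ^ 2 + C0 ^ 2).
    { destruct (Req_dec B 0) as [->|HB].
      - assert (C0 <> 0) by tauto. assert (0 < C0 ^ 2) by (apply pow2_gt_0; auto). lra.
      - assert (0 < B ^ 2) by (apply pow2_gt_0; auto).
        generalize (pow2_ge_0 C0). lra. }
    destruct p as [th [s1 s2] [r1 r2]].
    assert (Hth := sin2_cos2 th). unfold Rsqr in Hth.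
    (* The line in the placed frame is pulled back to the frame of [S0]: its normal is rotated by
       [- th] and the constant absorbs the translations. *)
    apply Hseg. apply (shape_line_segment S0 f (B * cos th + C0 * sin th)
      (- B * sin th + C0 * cos th)
      (B * (cos th * s1 - sin th * s2 - r1)
       + C0 * (sin th * s1 + cos th * s2 - r2) - D) H).
    + replace ((B * cos th + C0 * sin th) ^ 2 + (- B * sin th + C0 * cos th) ^ 2)
        with ((B ^ 2 + C0 ^ 2) * (sin th * sin th + cos th * cos th)) by ring.
      rewrite Hth. lra.
    + intros z Hz1. specialize (Hz z Hz1). cbv zeta in Hz. unfold act, cis in Hz.
      destruct (f z) as [x y]. simpl in Hz |- *. lra.
  (* Completing the square gives the centre [e] of the circle; [a] is its preimage under [act p]. *)
  - exfalso. set (e := (- B / (2 * A), - C0 / (2 * A)) : C).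
    set (a := (pos_center p - (pos_target p - e) * / cis (pos_angle p))%C).
    set (r := Cmod (f 1 - a)%C).
    assert (Hdist : forall z, Cmod z = 1 -> Cmod (f z - a)%C ^ 2 =
      (B ^ 2 + C0 ^ 2) / (4 * A ^ 2) - D / A).
    { intros z Hz1. specialize (Hz z Hz1). cbv zeta in Hz.
      transitivity (Cmod (act p (f z) - e)%C ^ 2).
      - rewrite act_affine. fold a. rewrite Cmod_mult, Cmod_cis. ring.
      - rewrite Cmod_sqr. destruct (act p (f z)) as [x y]. simpl in Hz |- *.
        apply (Rmult_eq_reg_l A); [|exact HA].
        apply Rminus_diag_uniq.
        rewrite <- Hz. field. exact HA. }
    assert (Hb : forall z, Cmod z = 1 -> Cmod (f z - a)%C = r).
    { intros z Hz1. apply Rsqr_inj; [apply Cmod_ge_0|apply Cmod_ge_0|].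
      unfold r. rewrite !Rsqr_pow2, (Hdist z Hz1), (Hdist 1%C Cmod_1). reflexivity. }
    destruct (Rle_lt_or_eq_dec 0 r (Cmod_ge_0 _)) as [Hr|Hr].
    + destruct (classic (S0 a)) as [Sa|Sa].
      * apply Hdisk. exact (shape_disk S0 f a r H Hb Hr Sa).
      * apply Harc. exact (shape_arc S0 f a r H Hb Hr Sa).
    + apply (laurent_not_constant_on_circle f a); [apply H|].
      intros z Hz1. specialize (Hb z Hz1). rewrite <- Hr in Hb.
      apply Cmod_eq_0 in Hb.
      replace (f z) with (f z - a + a)%C by ring. rewrite Hb. ring.
Qed.

Theorem mainTheorem4 :
  forall (S0 : C -> Prop) (f : C -> C),
    is_shape S0 f ->
    ~ is_disk S0 -> ~ is_circle_arc S0 -> ~ is_segment S0 ->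
    forall (p : position) (v1 v2 : velocity) (xi1 xi2 : C -> C),
      is_complex_potential S0 f p v1 xi1 ->
      is_complex_potential S0 f p v2 xi2 ->
      (forall x, ~ placed p S0 x -> xi1 x = xi2 x) ->
      same_velocity v1 v2.
Proof.
  intros S0 f H Hdisk Harc Hseg p v1 v2 xi1 xi2
    [_ [_ [g1 [Hg1 [E1 [K1 HK1]]]]]] [_ [_ [g2 [Hg2 [E2 [K2 HK2]]]]]] Hxi.
  assert (Hg : forall z, Cmod z = 1 -> g1 z = g2 z).
  { apply same_extension_on_circle; [exact Hg1|exact Hg2|].
    intros z Hz. rewrite (E1 z Hz), (E2 z Hz). apply Hxi.
    exact (act_exterior S0 f p z H Hz). }
  destruct v1 as [o1 [c1 d1] [a1 b1]]. destruct v2 as [o2 [c2 d2] [a2 b2]].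
  (* The coefficients of |x|^2, of the two coordinates and of 1 in the first slip condition minus
     the second. *)
  destruct (shape_boundary_not_conic S0 f p ((o2 - o1) / 2)
    (b2 - b1 + o1 * c1 - o2 * c2) (a1 - a2 + o1 * d1 - o2 * d2)
    (K1 - K2 - o1 / 2 * (c1 ^ 2 + d1 ^ 2) + o2 / 2 * (c2 ^ 2 + d2 ^ 2))
    H Hdisk Harc Hseg) as [HA [HB HC]].
  - intros z Hz. cbv zeta.
    generalize (HK1 z Hz) (HK2 z Hz). cbv zeta. rewrite (Hg z Hz), !Cmod_sqr.
    destruct (act p (f z)) as [x y]. unfold Im. simpl. lra.
  - intros [x y]. unfold velocity_field. simpl.
    unfold Ci, Cplus, Cmult, Cminus, Copp, RtoC, Cplus; simpl.
    (* The quadratic coefficient gives equal angular velocities; the linear ones then match the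
       constant parts of the two fields. *)
    assert (o2 = o1) by lra. subst o2. f_equal; lra.
Qed.
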